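(* Let $r\ge 0$ and let $f$ be a continuous complex-valued function on $\mathbb C$. Then $f$ is supported in $\{z\in\mathbb C:|z|\le r\}$ if and only if $f\times\mu_s(z)=\mu_s\times f(z)=0$ for every $z\in\mathbb C$ and every $s>r+|z|$.
   Context: For $s>0$, $\mu_s$ is the normalized (total mass 1) arc-length measure on the circle $\{w\in\mathbb C:|w|=s\}$. The (right and left) twisted spherical means of a continuous function $f$ on $\mathbb C$ are the twisted convolutions $$f\times\mu_s(z)=\int_{|w|=s}f(z-w)\,e^{\frac i2\operatorname{Im}(z\bar w)}\,d\mu_s(w),\qquad \mu_s\times f(z)=\int_{|w|=s}f(z-w)\,e^{-\frac i2\operatorname{Im}(z\bar w)}\,d\mu_s(w),$$ so that $\mu_s\times f=\overline{\bar f\times\mu_s}$. (These come from the twisted convolution $F\times G(z)=\int_{\mathbb C}F(z-w)G(w)e^{\frac i2\operatorname{Im}(z\bar w)}\,dw$.) *)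

(* Defs.v *)
From Stdlib Require Import Reals.
From Coquelicot Require Import Coquelicot.

Open Scope R_scope.

Definition Cexp (z : C) : C :=
  (RtoC (exp (Re z)) * (RtoC (cos (Im z)) + Ci * RtoC (sin (Im z))))%C.

(* [circle_mean s g] is the integral of [g] against the normalized arc-length
   measure of the circle [|w| = s] ([s > 0]): with [w = s e^(i t)], the arc
   length element [s dt] divided by the length [2 PI s] is [dt / (2 PI)].
   [RInt] is total; it is the actual integral when [g] is continuous on the
   circle. *)
Definition circle_mean (s : R) (g : C -> C) : C :=
  (RtoC (/ (2 * PI))
   * RInt (V := C_R_CompleteNormedModule)
       (fun t : R => g (RtoC s * Cexp (Ci * RtoC t))%C) 0 (2 * PI))%C.

(* [f x mu_s]. *)
Definition twisted_mean_right (f : C -> C) (s : R) (z : C) : C :=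
  circle_mean s
    (fun w : C => f (z - w) * Cexp (Ci / 2 * RtoC (Im (z * Cconj w))))%C.

(* [mu_s x f]. *)
Definition twisted_mean_left (f : C -> C) (s : R) (z : C) : C :=
  circle_mean s
    (fun w : C => f (z - w) * Cexp (- (Ci / 2) * RtoC (Im (z * Cconj w))))%C.

Definition closure {T : UniformSpace} (A : T -> Prop) (x : T) : Prop :=
  forall P : T -> Prop, locally x P -> exists y : T, P y /\ A y.

Definition support (f : C -> C) : C -> Prop :=
  closure (T := C_UniformSpace) (fun w : C => f w <> RtoC 0).

Definition supported_in (f : C -> C) (A : C -> Prop) : Prop :=
  forall z : C, support f z -> A z.

(* Main.v *)
(* In the gauge F(z) = e^(l |z|^2 / 2) f(z), l = 1/2 (right means) or l = -1/2 (left
   means), the vanishing of the twisted means reads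
     int F(z - w) e^(l z conj(w)) dmu_s(w) = 0   for s > r + |z|,
   a condition preserved by d/d(conj z) and, with a slightly larger r, by the twisted
   translations F(z) -> F(z + a) e^(- l a conj(z)); averaging over the latter makes F
   smooth.  Since d/d(conj z) lowers the order of the angular moments
   M_k(rho) = int F(rho e^(it)) (rho e^(it))^k dt, and M_0 = 0 by the condition at z = 0,
   induction on k shows that M_k is a polynomial of degree < k in rho^2 for rho > r.
   Hence e^(rho^2/4) N_k and e^(- rho^2/4) N_k are both polynomials in rho^2, where N_k is
   the moment of f itself; this forces N_k = 0.  The conjugate of f satisfies the same
   hypotheses, so all Fourier coefficients of f vanish on every circle of radius > r. *)

Require Import Defs.
From Stdlib Require Import Reals Lra Lia ZArith ClassicalEpsilon.
From Coquelicot Require Import Coquelicot.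

(** * Continuous functions and parametric integrals *)

(** Since [|z - w|^2 = |z|^2 + |w|^2 - 2 Re(z conj(w))], the gauge turns the oscillating factor into
    [e^(l z conj(w))], which is holomorphic in [z]; this is why d/d(conj z) preserves the condition.
    A merely continuous [F] has no such derivative, hence the averaging. The derivative of an
    averaged function is in turn only known to be continuous, so the averaging is repeated at every
    order [k]. Its error is removed at the level of moments: a pointwise limit of polynomials of
    bounded degree is a polynomial, and the loss in the radius tends to 0. The two gauges are
    compared through [y = rho^2]: one polynomial is [e^(- y / 2)] times the other, so it tends to 0
    at infinity and must be 0. The moments only see Fourier coefficients of one sign of the
    frequency; the conjugate of [f] supplies the other sign. *)

Record cts {U V : UniformSpace} (f : U -> V) : Prop := Cts { cts_at : forall x, continuous f x }.

Lemma cts_comp {U V W : UniformSpace} (g : V -> W) (f : U -> V) :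
  cts g -> cts f -> cts (fun x => g (f x)).
Proof. intros [Hg] [Hf]; constructor; intros x; apply (continuous_comp f g); auto. Qed.

Lemma cts_id {U : UniformSpace} : cts (fun x : U => x).
Proof. constructor; intros x; apply continuous_id. Qed.

Lemma cts_const {U V : UniformSpace} (c : V) : cts (fun _ : U => c).
Proof. constructor; intros x; apply continuous_const. Qed.

Lemma cts_pair {U V W : UniformSpace} (f : U -> V) (g : U -> W) :
  cts f -> cts g -> cts (V := prod_UniformSpace V W) (fun x => (f x, g x)).
Proof.
intros [Hf] [Hg]; constructor; intros x P [e He].
assert (H : locally x (fun y => ball (f x) e (f y) /\ ball (g x) e (g y))).
{ apply filter_and; [apply (Hf x (ball (f x) e)) | apply (Hg x (ball (g x) e))];
    apply locally_ball. }
change (locally x (fun y => P (f y, g y))).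
revert H; apply filter_imp; intros y [H1 H2]; apply He; split; assumption.
Qed.

Lemma cts_fst {U V W : UniformSpace} (f : U -> prod_UniformSpace V W) :
  cts f -> cts (fun x => fst (f x)).
Proof. intros Hf; apply (cts_comp fst f); [constructor; intros [a b]; apply continuous_fst | exact Hf]. Qed.

Lemma cts_snd {U V W : UniformSpace} (f : U -> prod_UniformSpace V W) :
  cts f -> cts (fun x => snd (f x)).
Proof. intros Hf; apply (cts_comp snd f); [constructor; intros [a b]; apply continuous_snd | exact Hf]. Qed.

Section Real_continuity.
Context {U : UniformSpace}.
Implicit Types f g : U -> R.

Lemma cts_Rplus f g : cts f -> cts g -> cts (V := R_UniformSpace) (fun x => f x + g x).
Proof. intros [Hf] [Hg]; constructor; intros x; apply (continuous_plus (V := R_NormedModule) f g); auto. Qed.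

Lemma cts_Ropp f : cts f -> cts (V := R_UniformSpace) (fun x => - f x).
Proof. intros [Hf]; constructor; intros x; apply (continuous_opp (V := R_NormedModule) f); auto. Qed.

Lemma cts_Rmult f g : cts f -> cts g -> cts (V := R_UniformSpace) (fun x => f x * g x).
Proof. intros [Hf] [Hg]; constructor; intros x; apply (continuous_mult (K := R_AbsRing) f g); auto. Qed.

End Real_continuity.

Lemma cts_derivable (f : R -> R) : (forall x, ex_derive f x) -> cts f.
Proof. intros H; constructor; intros x; apply (ex_derive_continuous (V := R_NormedModule)), H. Qed.

Lemma cts_cos : cts cos.
Proof. apply cts_derivable; intros x; auto_derive; trivial. Qed.

Lemma cts_sin : cts sin.
Proof. apply cts_derivable; intros x; auto_derive; trivial. Qed.

Lemma cts_exp : cts exp.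
Proof. apply cts_derivable; intros x; auto_derive; trivial. Qed.

Section Complex_continuity.
Context {U : UniformSpace}.
Implicit Types f g : U -> C.

Lemma cts_Re f : cts (V := C_UniformSpace) f -> cts (V := R_UniformSpace) (fun x => fst (f x)).
Proof. exact (cts_fst (V := R_UniformSpace) (W := R_UniformSpace) f). Qed.

Lemma cts_Im f : cts (V := C_UniformSpace) f -> cts (V := R_UniformSpace) (fun x => snd (f x)).
Proof. exact (cts_snd (V := R_UniformSpace) (W := R_UniformSpace) f). Qed.

Lemma cts_C f : cts (V := R_UniformSpace) (fun x => fst (f x)) ->
  cts (V := R_UniformSpace) (fun x => snd (f x)) -> cts (V := C_UniformSpace) f.
Proof.
intros H1 H2; constructor; intros x; apply continuous_ext with (fun y => (fst (f y), snd (f y))).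
  intros y; symmetry; apply surjective_pairing.
exact (cts_at _ (cts_pair _ _ H1 H2) x).
Qed.

Lemma cts_RtoC (f : U -> R) : cts f -> cts (V := C_UniformSpace) (fun x => RtoC (f x)).
Proof. intros H; apply cts_C; [exact H | exact (cts_const 0)]. Qed.

Lemma cts_Cplus f g : cts (V := C_UniformSpace) f -> cts (V := C_UniformSpace) g ->
  cts (V := C_UniformSpace) (fun x => f x + g x)%C.
Proof.
intros Hf Hg; apply cts_C; simpl; apply cts_Rplus; auto using cts_Re, cts_Im.
Qed.

Lemma cts_Copp f : cts (V := C_UniformSpace) f -> cts (V := C_UniformSpace) (fun x => - f x)%C.
Proof. intros Hf; apply cts_C; simpl; apply cts_Ropp; auto using cts_Re, cts_Im. Qed.

Lemma cts_Cmult f g : cts (V := C_UniformSpace) f -> cts (V := C_UniformSpace) g ->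
  cts (V := C_UniformSpace) (fun x => f x * g x)%C.
Proof.
intros Hf Hg; apply cts_C; simpl; apply cts_Rplus; try apply cts_Ropp; apply cts_Rmult;
  auto using cts_Re, cts_Im.
Qed.

Lemma cts_Cminus f g : cts (V := C_UniformSpace) f -> cts (V := C_UniformSpace) g ->
  cts (V := C_UniformSpace) (fun x => f x - g x)%C.
Proof. intros Hf Hg; apply cts_Cplus; [|apply cts_Copp]; assumption. Qed.

Lemma cts_Cconj f : cts (V := C_UniformSpace) f -> cts (V := C_UniformSpace) (fun x => Cconj (f x)).
Proof. intros Hf; apply cts_C; simpl; try apply cts_Ropp; auto using cts_Re, cts_Im. Qed.

Lemma cts_Cexp f : cts (V := C_UniformSpace) f -> cts (V := C_UniformSpace) (fun x => Cexp (f x)).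
Proof.
intros Hf.
assert (He : cts (fun x => exp (fst (f x)))) by exact (cts_comp exp _ cts_exp (cts_Re f Hf)).
assert (Hc : cts (fun x => cos (snd (f x)))) by exact (cts_comp cos _ cts_cos (cts_Im f Hf)).
assert (Hs : cts (fun x => sin (snd (f x)))) by exact (cts_comp sin _ cts_sin (cts_Im f Hf)).
apply cts_Cmult; [apply cts_RtoC, He|].
apply cts_Cplus; [apply cts_RtoC, Hc|].
apply cts_Cmult; [apply cts_const | apply cts_RtoC, Hs].
Qed.

Lemma cts_Cpow f n : cts (V := C_UniformSpace) f -> cts (V := C_UniformSpace) (fun x => f x ^ n)%C.
Proof.
intros Hf; induction n as [|n IH]; [exact (cts_const (RtoC 1))|].
exact (cts_Cmult f _ Hf IH).
Qed.

End Complex_continuity.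

Definition circ (s t : R) : C := (RtoC s * Cexp (Ci * RtoC t))%C.

Lemma cts_circ {U : UniformSpace} (f g : U -> R) : cts f -> cts g ->
  cts (V := C_UniformSpace) (fun x => circ (f x) (g x)).
Proof.
intros Hf Hg; apply cts_Cmult; [|apply cts_Cexp, cts_Cmult; [apply cts_const|]];
  apply cts_RtoC; assumption.
Qed.

Ltac cts_tac :=
  try assumption;
  lazymatch goal with
  | |- cts (fun x => x) => apply cts_id
  | |- cts Cconj => exact (cts_Cconj (fun x => x) cts_id)
  | |- cts RtoC => exact (cts_RtoC (fun x => x) cts_id)
  | |- cts Cexp => exact (cts_Cexp (fun x => x) cts_id)
  | |- cts cos => exact cts_cos
  | |- cts sin => exact cts_sin
  | |- cts fst => exact (cts_fst (fun p => p) cts_id)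
  | |- cts snd => exact (cts_snd (fun p => p) cts_id)
  | |- cts (fun x => RtoC _) => apply cts_RtoC; cts_tac
  | |- cts (fun x => circ _ _) => apply cts_circ; cts_tac
  | |- cts (fun x => Cmult _ _) => apply cts_Cmult; cts_tac
  | |- cts (fun x => Cplus _ _) => apply cts_Cplus; cts_tac
  | |- cts (fun x => Cminus _ _) => apply cts_Cminus; cts_tac
  | |- cts (fun x => Copp _) => apply cts_Copp; cts_tac
  | |- cts (fun x => Cconj _) => apply cts_Cconj; cts_tac
  | |- cts (fun x => Cexp _) => apply cts_Cexp; cts_tac
  | |- cts (fun x => Cpow _ _) => apply cts_Cpow; cts_tac
  | |- cts (fun x => Rplus _ _) => apply cts_Rplus; cts_tac
  | |- cts (fun x => Rmult _ _) => apply cts_Rmult; cts_tac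
  | |- cts (fun x => Ropp _) => apply cts_Ropp; cts_tac
  | |- cts (fun x => Rminus _ _) => apply cts_Rplus; [|apply cts_Ropp]; cts_tac
  | |- cts (fun x => cos _) => apply (cts_comp cos); [exact cts_cos | cts_tac]
  | |- cts (fun x => sin _) => apply (cts_comp sin); [exact cts_sin | cts_tac]
  | |- cts (fun x => exp _) => apply (cts_comp exp); [exact cts_exp | cts_tac]
  | |- cts (fun x => fst _) => first [solve [apply cts_Re; cts_tac] | apply cts_fst; cts_tac]
  | |- cts (fun x => snd _) => first [solve [apply cts_Im; cts_tac] | apply cts_snd; cts_tac]
  | H : cts ?F |- cts (fun x => ?F _) => apply (cts_comp F); [exact H | cts_tac]
  | |- cts (fun x => _) => first [apply cts_const | idtac]
  | |- @cts ?U ?V (?f ?a) => change (@cts U V (fun x => f a x)); cts_tac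
  | |- _ => idtac
  end.

(** * Integrals depending on a parameter *)

Lemma tube (U : UniformSpace) (h : U -> R -> R) (a b : R) (u : U) (eps : posreal) :
  cts (U := prod_UniformSpace U R_UniformSpace) (V := R_UniformSpace)
    (fun p => h (fst p) (snd p)) ->
  locally u (fun v => forall t, a <= t <= b -> Rabs (h v t - h u t) < eps).
Proof.
intros [Hh].
assert (He : 0 < eps / 2) by (destruct eps; simpl; lra).
assert (H : forall t, exists d : posreal, forall v t', ball u d v -> Rabs (t' - t) < d ->
   Rabs (h v t' - h u t) < eps / 2).
{ intros t.
  destruct (Hh (u, t) (ball (M := R_UniformSpace) (h u t) (mkposreal _ He)) (locally_ball (T := R_UniformSpace) (h u t) (mkposreal _ He))) as [d Hd].
  exists d; intros v t' Hv Ht; apply (Hd (v, t')); split; assumption. }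
set (dl := fun t => proj1_sig (constructive_indefinite_description _ (H t))).
assert (Hdl : forall t v t', ball u (dl t) v -> Rabs (t' - t) < dl t ->
   Rabs (h v t' - h u t) < eps / 2).
{ intros t; exact (proj2_sig (constructive_indefinite_description _ (H t))). }
(* Compactness of [[a, b]] in gauge form: one [d] works for all [t], each [t] lying in the
   [dl s]-neighbourhood of some [s] with [d <= dl s]. The existence of [s] comes doubly negated. *)
destruct (compactness_value_1d a b dl) as [d Hd].
exists d; intros v Hv t Ht.
destruct (NNPP _ (Hd t Ht)) as [s [Hs [Hts Hds]]].
assert (H1 : Rabs (h v t - h u s) < eps / 2).
{ apply Hdl; [apply ball_le with d; assumption | exact Hts]. }
assert (H2 : Rabs (h u t - h u s) < eps / 2).
{ apply Hdl; [apply ball_center | exact Hts]. }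
replace (h v t - h u t) with ((h v t - h u s) - (h u t - h u s)) by ring.
eapply Rle_lt_trans; [apply Rabs_triang|]; rewrite Rabs_Ropp; lra.
Qed.

Lemma ex_RInt_cts (f : R -> R) a b : cts f -> ex_RInt f a b.
Proof. intros H; apply (ex_RInt_continuous (V := R_CompleteNormedModule)); intros; apply H. Qed.

Lemma cts_slice {U V W : UniformSpace} (h : U -> V -> W) (u : U) :
  cts (U := prod_UniformSpace U V) (fun p => h (fst p) (snd p)) -> cts (h u).
Proof.
intros H; apply (cts_comp (U := V) (fun p : prod_UniformSpace U V => h (fst p) (snd p))
  (fun v => (u, v)) H).
apply cts_pair; [apply cts_const | apply cts_id].
Qed.

Lemma cts_RInt {U : UniformSpace} (h : U -> R -> R) (a b : R) : a <= b ->
  cts (U := prod_UniformSpace U R_UniformSpace) (V := R_UniformSpace)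
    (fun p => h (fst p) (snd p)) ->
  cts (V := R_UniformSpace) (fun u => RInt (h u) a b).
Proof.
intros Hab Hh; constructor; intros u P [e He].
(* The [+ 1] covers the case [a = b] and makes the final estimate strict. *)
assert (He' : 0 < e / (b - a + 1)).
{ destruct e as [e e0]; simpl; apply Rdiv_lt_0_compat; lra. }
change (locally u (fun v => P (RInt (h v) a b))).
generalize (tube U h a b u (mkposreal _ He') Hh); apply filter_imp.
intros v Hv; apply He.
assert (Ev : ex_RInt (h v) a b) by (apply ex_RInt_cts, cts_slice, Hh).
assert (Eu : ex_RInt (h u) a b) by (apply ex_RInt_cts, cts_slice, Hh).
change (Rabs (RInt (h v) a b - RInt (h u) a b) < e).
rewrite <- (RInt_minus (V := R_CompleteNormedModule) (h v) (h u)) by assumption.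
eapply Rle_lt_trans.
  apply (abs_RInt_le_const _ a b (e / (b - a + 1))); [exact Hab| |].
    apply (ex_RInt_minus (V := R_NormedModule)); assumption.
  intros t Ht; left; apply Hv, Ht.
destruct e as [e e0]; simpl in *.
apply Rmult_lt_reg_r with (b - a + 1); [lra|].
field_simplify; nra.
Qed.

Lemma is_derive_RInt_cts_param (g g' : R -> R -> R) (a b t : R) :
  (forall s x, is_derive (fun s => g s x) s (g' s x)) ->
  (forall s, cts (g s)) ->
  cts (U := prod_UniformSpace R_UniformSpace R_UniformSpace) (V := R_UniformSpace)
    (fun p => g' (fst p) (snd p)) ->
  is_derive (fun s => RInt (g s) a b) t (RInt (g' t) a b).
Proof.
intros Hd Hg Hg'.
assert (E : forall s x, Derive (fun s => g s x) s = g' s x).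
{ intros s x; apply is_derive_unique, Hd. }
rewrite <- (RInt_ext (fun x => Derive (fun s => g s x) t)) by (intros; apply E).
apply is_derive_RInt_param.
- apply filter_forall; intros s x _; exists (g' s x); apply Hd.
- intros x _; apply continuity_2d_pt_ext with g'; [intros; symmetry; apply E|].
  apply continuity_2d_pt_filterlim, (cts_at _ Hg' (t, x)).
- apply filter_forall; intros s; apply ex_RInt_cts, Hg.
Qed.

Lemma RInt_swap (g : R -> R -> R) (a b c d : R) : c <= d ->
  cts (U := prod_UniformSpace R_UniformSpace R_UniformSpace) (V := R_UniformSpace)
    (fun p => g (fst p) (snd p)) ->
  RInt (fun s => RInt (g s) c d) a b = RInt (fun x => RInt (fun s => g s x) a b) c d.
Proof.
intros Hcd Hg.
assert (Hg' : cts (U := prod_UniformSpace R_UniformSpace R_UniformSpace) (V := R_UniformSpace)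
    (fun p => g (snd p) (fst p))).
{ apply (cts_comp (U := prod_UniformSpace R_UniformSpace R_UniformSpace)
    (fun p : prod_UniformSpace R_UniformSpace R_UniformSpace => g (fst p) (snd p))
    (fun p => (snd p, fst p)) Hg).
  apply cts_pair; cts_tac. }
assert (HI : cts (fun s => RInt (g s) c d)) by (apply cts_RInt; assumption).
(* Both sides vanish at [b = a] and have the same derivative in [b]. *)
set (D := fun b => RInt (fun s => RInt (g s) c d) a b
                 - RInt (fun x => RInt (fun s => g s x) a b) c d).
assert (HD : forall b, is_derive D b 0).
{ intros y; replace 0 with (RInt (g y) c d - RInt (g y) c d) by ring.
  apply (is_derive_minus (V := R_NormedModule)).
  - apply (is_derive_RInt (V := R_NormedModule) (fun s => RInt (g s) c d)) with a; [|apply HI].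
    apply filter_forall; intros z; apply (RInt_correct (V := R_CompleteNormedModule)), ex_RInt_cts, HI.
  - apply (is_derive_RInt_cts_param (fun s x => RInt (fun s => g s x) a s) g c d y).
    + intros s x; apply (is_derive_RInt (V := R_NormedModule) (fun s => g s x)) with a.
        apply filter_forall; intros z; apply (RInt_correct (V := R_CompleteNormedModule)).
        apply ex_RInt_cts, (cts_slice (fun x s => g s x) x Hg').
      apply (cts_slice (fun x s => g s x) x Hg').
    (* [cts_RInt] needs ordered bounds, so for [s < a] the integral is reversed. *)
    + intros s; destruct (Rle_dec a s) as [Has|Has].
        apply (cts_RInt (fun x s => g s x)); assumption.
      constructor; intros x; apply continuous_ext with (fun x => - RInt (fun t => g t x) s a).
        intros x'; apply (opp_RInt_swap (V := R_CompleteNormedModule)).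
        apply ex_RInt_cts, (cts_slice (fun x s => g s x) x' Hg').
      apply cts_at, cts_Ropp, (cts_RInt (fun x s => g s x)); [lra | assumption].
    + exact Hg. }
assert (HD0 : D a = 0).
{ unfold D; rewrite (RInt_point (V := R_CompleteNormedModule)).
  rewrite (RInt_ext _ (fun _ => 0)).
    rewrite (RInt_const (V := R_CompleteNormedModule)); unfold zero, scal; simpl; unfold mult; simpl; ring.
  intros; apply (RInt_point (V := R_CompleteNormedModule)). }
assert (E : D b = D a).
{ destruct (MVT_gen D a b (fun _ => 0)) as [x [_ Hx]].
  - intros; apply HD.
  - intros x _; apply continuity_pt_filterlim.
    apply (ex_derive_continuous (V := R_NormedModule)); eexists; apply HD.
  - lra. }
rewrite HD0 in E; unfold D in E; lra.
Qed.

(** * Complex-valued integrals and derivatives *)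

Notation C_U := C_UniformSpace.
Notation R_U := R_UniformSpace.

(** Taken by components, as is [cder] below, so that the real theory applies; [RInt_cint] identifies
    it with the integral in [circle_mean]. *)
Definition cint (f : R -> C) (a b : R) : C :=
  (RInt (fun t => fst (f t)) a b, RInt (fun t => snd (f t)) a b).

Lemma RInt_cint (f : R -> C) a b : cts (V := C_U) f ->
  RInt (V := C_R_CompleteNormedModule) f a b = cint f a b.
Proof.
intros Hf; apply is_RInt_unique.
apply (is_RInt_fct_extend_pair (U := R_NormedModule) (V := R_NormedModule));
  apply (RInt_correct (V := R_CompleteNormedModule)), ex_RInt_cts; cts_tac.
Qed.

Lemma cint_ext (f g : R -> C) a b : (forall t, f t = g t) -> cint f a b = cint g a b.
Proof.
intros H; unfold cint; f_equal; apply RInt_ext; intros t _; rewrite H; reflexivity.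
Qed.

Lemma cint_plus (f g : R -> C) a b : cts (V := C_U) f -> cts (V := C_U) g ->
  cint (fun t => f t + g t)%C a b = (cint f a b + cint g a b)%C.
Proof.
intros Hf Hg; apply injective_projections; simpl;
  apply (RInt_plus (V := R_CompleteNormedModule)); apply ex_RInt_cts; cts_tac.
Qed.

Lemma RInt_lin2 (u v : R -> R) p q a b : cts u -> cts v ->
  RInt (fun t => p * u t + q * v t) a b = p * RInt u a b + q * RInt v a b.
Proof.
intros Hu Hv.
rewrite <- (RInt_scal (V := R_CompleteNormedModule) u) by (apply ex_RInt_cts, Hu).
rewrite <- (RInt_scal (V := R_CompleteNormedModule) v) by (apply ex_RInt_cts, Hv).
apply (RInt_plus (V := R_CompleteNormedModule) (fun t => p * u t) (fun t => q * v t));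
  apply ex_RInt_cts; cts_tac.
Qed.

Lemma cint_scal (c : C) (f : R -> C) a b : cts (V := C_U) f ->
  cint (fun t => c * f t)%C a b = (c * cint f a b)%C.
Proof.
intros Hf; assert (H1 := cts_Re f Hf); assert (H2 := cts_Im f Hf).
apply injective_projections; simpl.
  replace (fst c * RInt (fun t => fst (f t)) a b - snd c * RInt (fun t => snd (f t)) a b)
    with (fst c * RInt (fun t => fst (f t)) a b + - snd c * RInt (fun t => snd (f t)) a b) by ring.
  rewrite <- RInt_lin2 by assumption; apply RInt_ext; intros t _; simpl; ring.
rewrite <- RInt_lin2 by assumption; apply RInt_ext; intros t _; simpl; ring.
Qed.

Lemma cint_const (c : C) a b : cint (fun _ => c) a b = (RtoC (b - a) * c)%C.
Proof.
unfold cint; apply injective_projections; simpl;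
  rewrite (RInt_const (V := R_CompleteNormedModule)); unfold scal; simpl; unfold mult; simpl; ring.
Qed.

Lemma cts_cint {U : UniformSpace} (h : U -> R -> C) (a b : R) : a <= b ->
  cts (U := prod_UniformSpace U R_U) (V := C_U) (fun p => h (fst p) (snd p)) ->
  cts (V := C_U) (fun u => cint (h u) a b).
Proof.
intros Hab Hh; apply cts_C; simpl.
  apply (cts_RInt (fun u t => fst (h u t)) a b Hab); cts_tac.
apply (cts_RInt (fun u t => snd (h u t)) a b Hab); cts_tac.
Qed.

Lemma cint_swap (g : R -> R -> C) (a b c d : R) : c <= d ->
  cts (U := prod_UniformSpace R_U R_U) (V := C_U) (fun p => g (fst p) (snd p)) ->
  cint (fun s => cint (g s) c d) a b = cint (fun x => cint (fun s => g s x) a b) c d.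
Proof.
intros Hcd Hg; unfold cint; simpl; f_equal.
  apply (RInt_swap (fun s x => fst (g s x)) a b c d Hcd); cts_tac.
apply (RInt_swap (fun s x => snd (g s x)) a b c d Hcd); cts_tac.
Qed.

Definition cder (f : R -> C) (t : R) (l : C) : Prop :=
  is_derive (fun s => fst (f s)) t (fst l) /\ is_derive (fun s => snd (f s)) t (snd l).

Lemma cder_ext (f g : R -> C) t l : (forall s, f s = g s) -> cder f t l -> cder g t l.
Proof.
intros H [H1 H2]; split.
  apply (is_derive_ext (fun s => fst (f s))); [intros s; rewrite H; reflexivity | exact H1].
apply (is_derive_ext (fun s => snd (f s))); [intros s; rewrite H; reflexivity | exact H2].
Qed.

Lemma cder_ext_loc (f g : R -> C) t l : locally t (fun s => f s = g s) -> cder f t l -> cder g t l.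
Proof.
intros H [H1 H2]; split.
  apply (is_derive_ext_loc (fun s => fst (f s))); [|exact H1].
  revert H; apply filter_imp; intros s E; rewrite E; reflexivity.
apply (is_derive_ext_loc (fun s => snd (f s))); [|exact H2].
revert H; apply filter_imp; intros s E; rewrite E; reflexivity.
Qed.

Lemma cder_eq (f : R -> C) t l l' : l = l' -> cder f t l -> cder f t l'.
Proof. intros ->; trivial. Qed.

Lemma cder_unique (f : R -> C) t l l' : cder f t l -> cder f t l' -> l = l'.
Proof.
intros [H1 H2] [H3 H4]; apply injective_projections.
  rewrite <- (is_derive_unique _ _ _ H1); apply is_derive_unique, H3.
rewrite <- (is_derive_unique _ _ _ H2); apply is_derive_unique, H4.
Qed.

Lemma cder_const (c : C) t : cder (fun _ => c) t (RtoC 0).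
Proof. split; [exact (is_derive_const (V := R_NormedModule) (fst c) t) | exact (is_derive_const (V := R_NormedModule) (snd c) t)]. Qed.

Lemma cder_RtoC (f : R -> R) t l : is_derive f t l -> cder (fun s => RtoC (f s)) t (RtoC l).
Proof. intros H; split; [exact H | exact (is_derive_const (V := R_NormedModule) 0 t)]. Qed.

Lemma cder_plus (f g : R -> C) t k l : cder f t k -> cder g t l ->
  cder (fun s => f s + g s)%C t (k + l)%C.
Proof.
intros [H1 H2] [H3 H4]; split.
  exact (is_derive_plus (V := R_NormedModule) _ _ _ _ _ H1 H3).
exact (is_derive_plus (V := R_NormedModule) _ _ _ _ _ H2 H4).
Qed.

Lemma is_derive_Rmult (f g : R -> R) t k l : is_derive f t k -> is_derive g t l ->
  is_derive (fun s => f s * g s) t (k * g t + f t * l).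
Proof.
intros Hf Hg; apply (is_derive_mult (K := R_AbsRing)); try assumption.
intros; apply Rmult_comm.
Qed.

Lemma cder_mult (f g : R -> C) t k l : cder f t k -> cder g t l ->
  cder (fun s => f s * g s)%C t (k * g t + f t * l)%C.
Proof.
intros [H1 H2] [H3 H4]; split; simpl.
  replace (fst k * fst (g t) - snd k * snd (g t) + (fst (f t) * fst l - snd (f t) * snd l))
   with ((fst k * fst (g t) + fst (f t) * fst l) - (snd k * snd (g t) + snd (f t) * snd l)) by ring.
  apply (is_derive_minus (V := R_NormedModule)); apply is_derive_Rmult; assumption.
replace (fst k * snd (g t) + snd k * fst (g t) + (fst (f t) * snd l + snd (f t) * fst l))
 with ((fst k * snd (g t) + fst (f t) * snd l) + (snd k * fst (g t) + snd (f t) * fst l)) by ring.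
apply (is_derive_plus (V := R_NormedModule)); apply is_derive_Rmult; assumption.
Qed.

Lemma cder_scal (c : C) (f : R -> C) t l : cder f t l -> cder (fun s => c * f s)%C t (c * l)%C.
Proof.
intros H; apply cder_eq with (RtoC 0 * f t + c * l)%C; [ring|].
apply (cder_mult (fun _ => c)); [apply cder_const | exact H].
Qed.

Lemma cder_comp (f : R -> C) (g : R -> R) t l d : cder f (g t) l -> is_derive g t d ->
  cder (fun s => f (g s)) t (RtoC d * l)%C.
Proof.
intros [H1 H2] Hg; split; simpl.
  replace (d * fst l - 0 * snd l) with (d * fst l) by ring.
  apply (is_derive_comp (V := R_NormedModule) (fun s => fst (f s)) g); assumption.
replace (d * snd l + 0 * fst l) with (d * snd l) by ring.
apply (is_derive_comp (V := R_NormedModule) (fun s => snd (f s)) g); assumption.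
Qed.

Lemma cder_Cexp (f : R -> C) t l : cder f t l ->
  cder (fun s => Cexp (f s)) t (l * Cexp (f t))%C.
Proof.
assert (Hr : forall u v u' v', is_derive u t u' -> is_derive v t v' ->
  is_derive (fun s => exp (u s) * cos (v s)) t
    (u' * (exp (u t) * cos (v t)) - v' * (exp (u t) * sin (v t))) /\
  is_derive (fun s => exp (u s) * sin (v s)) t
    (u' * (exp (u t) * sin (v t)) + v' * (exp (u t) * cos (v t)))).
{ intros u v u' v' Hu Hv; split; auto_derive;
    try (repeat split; trivial; eexists; eassumption);
    replace (Derive (fun x : R => u x) t) with u' by (symmetry; apply is_derive_unique, Hu); replace (Derive (fun x : R => v x) t) with v' by (symmetry; apply is_derive_unique, Hv); ring. }
intros [H1 H2]; destruct (Hr _ _ _ _ H1 H2) as [H3 H4].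
split; unfold Cexp, Re, Im; simpl.
  apply is_derive_ext with (fun s => exp (fst (f s)) * cos (snd (f s))); [intros s; simpl; ring|].
  match goal with |- is_derive _ _ ?d => match type of H3 with is_derive _ _ ?e =>
    replace d with e by ring end end; exact H3.
apply is_derive_ext with (fun s => exp (fst (f s)) * sin (snd (f s))); [intros s; simpl; ring|].
match goal with |- is_derive _ _ ?d => match type of H4 with is_derive _ _ ?e =>
  replace d with e by ring end end; exact H4.
Qed.

Lemma cder_cint_param (g g' : R -> R -> C) (a b t : R) :
  (forall s x, cder (fun s => g s x) s (g' s x)) ->
  (forall s, cts (V := C_U) (g s)) ->
  cts (U := prod_UniformSpace R_U R_U) (V := C_U) (fun p => g' (fst p) (snd p)) ->
  cder (fun s => cint (g s) a b) t (cint (g' t) a b).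
Proof.
intros Hd Hg Hg'; split; simpl.
  apply (is_derive_RInt_cts_param (fun s x => fst (g s x)) (fun s x => fst (g' s x)));
    [intros s x; apply Hd | intros s; specialize (Hg s); cts_tac | cts_tac].
apply (is_derive_RInt_cts_param (fun s x => snd (g s x)) (fun s x => snd (g' s x)));
  [intros s x; apply Hd | intros s; specialize (Hg s); cts_tac | cts_tac].
Qed.

Lemma is_derive_RInt_cts (f : R -> R) a b : cts f -> is_derive (fun x => RInt f a x) b (f b).
Proof.
intros Hf; apply (is_derive_RInt (V := R_NormedModule) f) with a; [|apply Hf].
apply filter_forall; intros z; apply (RInt_correct (V := R_CompleteNormedModule)), ex_RInt_cts, Hf.
Qed.

Lemma cder_cint (f : R -> C) a b : cts (V := C_U) f -> cder (fun x => cint f a x) b (f b).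
Proof.
intros Hf; split; simpl.
  apply (is_derive_RInt_cts (fun t => fst (f t))); cts_tac.
apply (is_derive_RInt_cts (fun t => snd (f t))); cts_tac.
Qed.

Lemma cint_cder (f f' : R -> C) a b : (forall t, cder f t (f' t)) -> cts (V := C_U) f' ->
  cint f' a b = (f b - f a)%C.
Proof.
intros Hd Hf'; assert (H1 := cts_Re f' Hf'); assert (H2 := cts_Im f' Hf').
apply injective_projections; simpl; apply is_RInt_unique.
  apply (is_RInt_derive (V := R_CompleteNormedModule) (fun t => fst (f t))); intros t _;
    [apply Hd | apply (cts_at _ H1)].
apply (is_RInt_derive (V := R_CompleteNormedModule) (fun t => snd (f t))); intros t _;
  [apply Hd | apply (cts_at _ H2)].
Qed.

(** * Directional derivatives and the chain rule along curves *)

Definition dirder (eta : C) (G G' : C -> C) : Prop :=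
  forall z, cder (fun t => G (z + RtoC t * eta)%C) 0 (G' z).

Lemma dirder_at (eta : C) (G G' : C -> C) z t : dirder eta G G' ->
  cder (fun t => G (z + RtoC t * eta)%C) t (G' (z + RtoC t * eta)%C).
Proof.
intros H.
apply cder_ext with (fun s => (fun s => G (z + RtoC t * eta + RtoC s * eta)%C) (s - t)).
  intros s; f_equal; rewrite RtoC_minus; ring.
apply cder_eq with (RtoC 1 * G' (z + RtoC t * eta))%C; [ring|].
apply (cder_comp (fun s => G (z + RtoC t * eta + RtoC s * eta)%C) (fun s => s - t)).
  replace (t - t) with 0 by ring; apply H.
auto_derive; trivial; ring.
Qed.

Lemma is_derive_shift (f : R -> R) a l : is_derive f 0 l -> is_derive (fun s => f (s - a)) a l.
Proof.
intros H; rewrite <- (Rmult_1_l l).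
apply (is_derive_comp (V := R_NormedModule) f (fun s => s - a)).
  replace (a - a) with 0 by ring; exact H.
auto_derive; trivial; ring.
Qed.

(** One continuous partial derivative together with the existence of the other gives
    differentiability, hence the chain rule. *)
Lemma filterdiff_C1 (G : C -> R) (Gx Gy : C -> R) :
  (forall z, is_derive (fun t => G (z + RtoC t)%C) 0 (Gx z)) ->
  (forall z, is_derive (fun t => G (z + RtoC t * Ci)%C) 0 (Gy z)) ->
  cts (U := C_U) (V := R_U) Gx ->
  forall (x y : R -> R) t x' y', is_derive x t x' -> is_derive y t y' ->
  is_derive (fun s => G (x s, y s)) t (x' * Gx (x t, y t) + y' * Gy (x t, y t)).
Proof.
intros Hx Hy Hc x y t x' y' Dx Dy.
assert (H : filterdiff (fun u : R * R => G (fst u, snd u)) (locally (x t, y t))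
   (fun u : R * R => plus (scal (fst u) (Gx (x t, y t))) (scal (snd u) (Gy (x t, y t))))).
{ apply (is_derive_filterdiff (fun a b => G (a, b)) (x t) (y t) (fun a b => Gx (a, b))).
  - apply filter_forall; intros [a b]; simpl.
    apply is_derive_ext with (fun s => (fun r => G ((a, b) + RtoC r)%C) (s - a)).
      intros s; f_equal; unfold Cplus, RtoC; simpl; f_equal; ring.
    apply (is_derive_shift (fun r => G ((a, b) + RtoC r)%C)), Hx.
  - apply is_derive_ext with (fun s => (fun r => G ((x t, y t) + RtoC r * Ci)%C) (s - y t)).
      intros s; f_equal; unfold Cplus, Cmult, RtoC, Ci; simpl; f_equal; ring.
    apply (is_derive_shift (fun r => G ((x t, y t) + RtoC r * Ci)%C)), Hy.
  - apply continuous_ext with Gx; [intros [a b]; reflexivity | apply Hc]. }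
apply filterdiff_differentiable_pt_lim with (f := fun a b => G (a, b))
  (lx := Gx (x t, y t)) (ly := Gy (x t, y t)) in H.
apply is_derive_Reals.
replace (x' * Gx (x t, y t) + y' * Gy (x t, y t))
  with (Gx (x t, y t) * x' + Gy (x t, y t) * y') by ring.
apply (derivable_pt_lim_comp_2d (fun a b => G (a, b)) x y); [exact H| |]; apply is_derive_Reals; assumption.
Qed.

Lemma cder_curve (G Gx Gy : C -> C) :
  dirder (RtoC 1) G Gx -> dirder Ci G Gy -> cts (U := C_U) (V := C_U) Gx ->
  forall (g : R -> C) t l, cder g t l ->
  cder (fun s => G (g s)) t (RtoC (fst l) * Gx (g t) + RtoC (snd l) * Gy (g t))%C.
Proof.
intros Hx Hy Hc g t [x' y'] [Dx Dy]; simpl in Dx, Dy.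
assert (Hx' : forall z, cder (fun t => G (z + RtoC t)%C) 0 (Gx z)).
{ intros z; apply cder_ext with (fun t => G (z + RtoC t * RtoC 1)%C); [|apply Hx].
  intros s; f_equal; ring. }
apply cder_ext with (fun s => G (fst (g s), snd (g s))).
  intros s; rewrite <- surjective_pairing; reflexivity.
split; simpl.
- replace (x' * fst (Gx (g t)) - 0 * snd (Gx (g t)) + (y' * fst (Gy (g t)) - 0 * snd (Gy (g t))))
    with (x' * fst (Gx (fst (g t), snd (g t))) + y' * fst (Gy (fst (g t), snd (g t))))
    by (rewrite <- surjective_pairing; ring).
  apply (filterdiff_C1 (fun z => fst (G z)) (fun z => fst (Gx z)) (fun z => fst (Gy z)));
    [apply Hx' | apply Hy | cts_tac | assumption | assumption].
- replace (x' * snd (Gx (g t)) + 0 * fst (Gx (g t)) + (y' * snd (Gy (g t)) + 0 * fst (Gy (g t))))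
    with (x' * snd (Gx (fst (g t), snd (g t))) + y' * snd (Gy (fst (g t), snd (g t))))
    by (rewrite <- surjective_pairing; ring).
  apply (filterdiff_C1 (fun z => snd (G z)) (fun z => snd (Gx z)) (fun z => snd (Gy z)));
    [apply Hx' | apply Hy | cts_tac | assumption | assumption].
Qed.

(** * Twisted translations and smoothing *)

Lemma Cexp_plus z w : Cexp (z + w) = (Cexp z * Cexp w)%C.
Proof.
unfold Cexp, Re, Im; simpl; rewrite exp_plus, cos_plus, sin_plus.
apply injective_projections; simpl; ring.
Qed.

Lemma Cexp_0 : Cexp (RtoC 0) = RtoC 1.
Proof.
unfold Cexp, Re, Im; simpl; rewrite exp_0, cos_0, sin_0.
apply injective_projections; simpl; ring.
Qed.

Lemma Cexp_RtoC x : Cexp (RtoC x) = RtoC (exp x).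
Proof.
unfold Cexp, Re, Im; simpl; rewrite cos_0, sin_0.
apply injective_projections; simpl; ring.
Qed.

Lemma Cexp_Ci t : Cexp (Ci * RtoC t) = (cos t, sin t).
Proof.
unfold Cexp, Re, Im; simpl.
replace (0 * t - 1 * 0) with 0 by ring; replace (0 * 0 + 1 * t) with t by ring.
rewrite exp_0; apply injective_projections; simpl; ring.
Qed.

Lemma circ_eq s t : circ s t = (s * cos t, s * sin t).
Proof. unfold circ; rewrite Cexp_Ci; apply injective_projections; simpl; ring. Qed.

Lemma circ_conj s t : (circ s t * Cconj (circ s t) = RtoC (s * s))%C.
Proof.
rewrite circ_eq; assert (T := sin2_cos2 t); unfold Rsqr in T.
apply injective_projections; simpl; [|ring].
transitivity (s * s * (sin t * sin t + cos t * cos t)); [ring | rewrite T; ring].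
Qed.

Lemma RInt_window (u : R -> R) eps t : eps <> 0 -> cts u ->
  / eps * (RInt u 0 (t + eps) - RInt u 0 t) = RInt (fun a => u (eps * a + t)) 0 1.
Proof.
intros He Hu.
assert (Ec := RInt_Chasles (V := R_CompleteNormedModule) u 0 t (t + eps)
  (ex_RInt_cts u _ _ Hu) (ex_RInt_cts u _ _ Hu)); unfold plus in Ec; simpl in Ec.
assert (El := RInt_comp_lin (V := R_CompleteNormedModule) u eps t 0 1 (ex_RInt_cts u _ _ Hu)).
rewrite RInt_scal in El.
  unfold scal in El; simpl in El; unfold mult in El; simpl in El.
  replace (eps * 0 + t) with t in El by ring; replace (eps * 1 + t) with (t + eps) in El by ring.
  rewrite <- Ec, <- El; field; exact He.
apply ex_RInt_cts, (cts_comp u (fun a => eps * a + t) Hu); cts_tac.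
Qed.

Lemma cint_window (T : R -> C) eps t : eps <> 0 -> cts (V := C_U) T ->
  (RtoC (/ eps) * (cint T 0 (t + eps) - cint T 0 t))%C = cint (fun a => T (eps * a + t)) 0 1.
Proof.
intros He HT; unfold cint; apply injective_projections; simpl.
  rewrite <- (RInt_window (fun b => fst (T b))) by (try exact He; cts_tac); ring.
rewrite <- (RInt_window (fun b => snd (T b))) by (try exact He; cts_tac); ring.
Qed.

(* With [F z = exp (l |z|^2 / 2) * f z], this is the right ([l = 1/2]) or left
   ([l = -1/2]) twisted mean of [f], up to a nonvanishing factor. *)
Definition kmean (l : R) (F : C -> C) (s : R) (z : C) : C :=
  cint (fun t => F (z - circ s t) * Cexp (RtoC l * (z * Cconj (circ s t))))%C 0 (2 * PI).

Definition kmean_vanish (l r : R) (F : C -> C) : Prop :=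
  forall z s, r + Cmod z < s -> kmean l F s z = RtoC 0.

(* Chosen so that [kmean l (transl l eta a F) s z] is a multiple of
   [kmean l F s (z + a eta)]; the factor independent of [z] makes these translations
   along [eta] a one-parameter group. *)
Definition transl (l : R) (eta : C) (a : R) (F : C -> C) (z : C) : C :=
  (F (z + RtoC a * eta) * Cexp (- RtoC l * (RtoC a * eta * Cconj z + RtoC (a * a * / 2))))%C.

(** Average of the translations by [[0, eps]], rescaled to [[0, 1]] so that [eps = 0] makes sense
    and gives [F] back. *)
Definition smooth (l : R) (eta : C) (eps : R) (F : C -> C) (z : C) : C :=
  cint (fun a => transl l eta (eps * a) F z) 0 1.

Lemma transl_0 l eta F z : transl l eta 0 F z = F z.
Proof.
unfold transl; replace (z + RtoC 0 * eta)%C with z by ring.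
replace (- RtoC l * (RtoC 0 * eta * Cconj z + RtoC (0 * 0 * / 2)))%C with (RtoC 0)
  by (replace (0 * 0 * / 2) with 0 by field; ring).
rewrite Cexp_0; ring.
Qed.

Section Smoothing.
Variables (l : R) (eta : C).
Hypothesis Heta : (eta * Cconj eta = RtoC 1)%C.

Lemma Cmod_eta : Cmod eta = 1.
Proof.
assert (H : RtoC (Cmod eta ^ 2) = RtoC 1).
{ rewrite <- Heta, <- Cmod2_conj, RtoC_pow; reflexivity. }
apply RtoC_inj in H.
assert (H0 := Cmod_ge_0 eta); nra.
Qed.

(** The exponents match: [- l a eta conj(z - w) + l z conj(w) = - l a eta conj(z) + l (z + a eta)
    conj(w)], and the last term is the kernel at [z + a eta]. *)
Lemma kmean_transl (F : C -> C) a s z : cts (U := C_U) (V := C_U) F ->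
  kmean l (transl l eta a F) s z =
  (Cexp (- RtoC l * (RtoC a * eta * Cconj z + RtoC (a * a * / 2)))
    * kmean l F s (z + RtoC a * eta))%C.
Proof.
intros HF; unfold kmean; rewrite <- cint_scal.
2: { cts_tac. }
apply cint_ext; intros t; unfold transl.
replace (z - circ s t + RtoC a * eta)%C with (z + RtoC a * eta - circ s t)%C by ring.
rewrite (Cmult_comm (Cexp _) (_ * _)), <- !Cmult_assoc, <- !Cexp_plus.
rewrite Cminus_conj; do 2 f_equal; ring.
Qed.

Lemma kmean_vanish_transl (F : C -> C) a r : cts (U := C_U) (V := C_U) F ->
  kmean_vanish l r F -> kmean_vanish l (r + Rabs a) (transl l eta a F).
Proof.
intros HF H z s Hs; rewrite kmean_transl, H by
 (try assumption; assert (H1 := Cmod_triangle z (RtoC a * eta)%C);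
  rewrite Cmod_mult, Cmod_eta, Cmod_R in H1; lra); ring.
Qed.

Lemma cts_transl {U : UniformSpace} (a : U -> R) (F : U -> C -> C) (z : U -> C) :
  cts a -> cts (V := C_U) z ->
  cts (U := prod_UniformSpace U C_U) (V := C_U) (fun p => F (fst p) (snd p)) ->
  cts (V := C_U) (fun x => transl l eta (a x) (F x) (z x)).
Proof.
intros Ha Hz HF; unfold transl.
apply cts_Cmult; [|cts_tac].
apply (cts_comp (U := U) (fun p : prod_UniformSpace U C_U => F (fst p) (snd p))
  (fun x => (x, (z x + RtoC (a x) * eta)%C)) HF).
apply cts_pair; cts_tac.
Qed.

Lemma cts_smooth (F : R -> C -> C) :
  cts (U := prod_UniformSpace R_U C_U) (V := C_U) (fun p => F (fst p) (snd p)) ->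
  cts (U := prod_UniformSpace R_U C_U) (V := C_U) (fun p => smooth l eta (fst p) (F (fst p)) (snd p)).
Proof.
intros HF; unfold smooth.
apply (cts_cint (U := prod_UniformSpace R_U C_U)
   (fun p a => transl l eta (fst p * a) (F (fst p)) (snd p)) 0 1); [lra|].
apply (cts_transl (U := prod_UniformSpace (prod_UniformSpace R_U C_U) R_U)
  (fun p => fst (fst p) * snd p) (fun p => F (fst (fst p))) (fun p => snd (fst p))); cts_tac.
apply (cts_comp (U := prod_UniformSpace (prod_UniformSpace (prod_UniformSpace R_U C_U) R_U) C_U)
  (fun p : prod_UniformSpace R_U C_U => F (fst p) (snd p))
  (fun p => (fst (fst (fst p)), snd p)) HF).
apply cts_pair; cts_tac.
Qed.

Lemma cts_const_param {U V W : UniformSpace} (F : V -> W) :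
  cts F -> cts (U := prod_UniformSpace U V) (fun p => F (snd p)).
Proof. intros HF; cts_tac. Qed.

Lemma cts_smooth_const (F : C -> C) eps : cts (U := C_U) (V := C_U) F ->
  cts (U := C_U) (V := C_U) (smooth l eta eps F).
Proof.
intros HF; apply (cts_slice (fun eps z => smooth l eta eps F z)).
apply (cts_smooth (fun _ => F)), cts_const_param, HF.
Qed.

Lemma kmean_vanish_smooth (F : C -> C) eps r : 0 <= eps -> cts (U := C_U) (V := C_U) F ->
  kmean_vanish l r F -> kmean_vanish l (r + eps) (smooth l eta eps F).
Proof.
intros He HF H z s Hs.
set (g := fun t a => (transl l eta (eps * a) F (z - circ s t) *
   Cexp (RtoC l * (z * Cconj (circ s t))))%C).
transitivity (cint (fun t => cint (g t) 0 1) 0 (2 * PI)).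
{ apply cint_ext; intros t; unfold g, smooth.
  rewrite Cmult_comm, <- cint_scal.
    apply cint_ext; intros a; apply Cmult_comm.
  apply (cts_transl (fun a => eps * a) (fun _ => F)); cts_tac. }
rewrite cint_swap; [|lra|].
2: { unfold g; apply cts_Cmult.
  - apply (cts_transl (U := prod_UniformSpace R_U R_U) (fun p => eps * snd p) (fun _ => F)
      (fun p => (z - circ s (fst p))%C)); cts_tac.
  - cts_tac. }
(* The inner integral vanishes only for [a] in [0, 1]; hence [RInt_ext] instead of [cint_ext]. *)
assert (H0 : forall a, 0 < a < 1 -> cint (fun t => g t a) 0 (2 * PI) = RtoC 0).
{ intros a Ha; apply (kmean_vanish_transl F (eps * a) r HF H).
  rewrite Rabs_pos_eq by nra; nra. }
transitivity (cint (fun _ => RtoC 0) 0 1); [|rewrite cint_const; ring].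
unfold cint; f_equal; apply RInt_ext; rewrite Rmin_left, Rmax_right by lra; intros a Ha.
  exact (f_equal fst (H0 a Ha)).
exact (f_equal snd (H0 a Ha)).
Qed.

(* In the gauge of [transl], moving [z] along [eta] shifts the window of integration. *)
Lemma smooth_window (F : C -> C) eps z t : eps <> 0 -> cts (U := C_U) (V := C_U) F ->
  smooth l eta eps F (z + RtoC t * eta)%C =
  (Cexp (RtoC l * (RtoC t * eta * Cconj z + RtoC (t * t * / 2))) * (RtoC (/ eps) *
    (cint (fun b => transl l eta b F z) 0 (t + eps) - cint (fun b => transl l eta b F z) 0 t)))%C.
Proof.
intros He HF.
assert (HT : cts (fun b => transl l eta b F z)).
{ apply (cts_transl (fun b => b) (fun _ => F)); cts_tac. }
set (T := fun b => transl l eta b F z) in *.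
assert (HTs : cts (fun a => T (eps * a + t))).
{ apply (cts_comp T (fun a => eps * a + t) HT); cts_tac. }
rewrite cint_window, <- cint_scal by assumption.
apply cint_ext; intros a; unfold T, transl.
replace (z + RtoC t * eta + RtoC (eps * a) * eta)%C with (z + RtoC (eps * a + t) * eta)%C
  by (rewrite RtoC_plus; ring).
match goal with |- _ = (Cexp ?c * (?f * Cexp ?d))%C =>
  transitivity (f * (Cexp c * Cexp d))%C; [rewrite <- Cexp_plus; do 2 f_equal | ring] end.
rewrite Cplus_conj, Cmult_conj.
replace (Cconj (RtoC t)) with (RtoC t) by (apply injective_projections; simpl; ring).
(* As [|eta| = 1], the product of [eps a eta] with [conj(t eta)] is [eps a t], the cross term of the
   square [(eps a + t)^2 / 2]. *)
replace (RtoC (eps * a) * eta * (Cconj z + RtoC t * Cconj eta))%C with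
 (RtoC (eps * a) * eta * Cconj z + RtoC (eps * a) * RtoC t * (eta * Cconj eta))%C by ring.
rewrite Heta.
replace (RtoC (t * t * / 2)) with (RtoC t * RtoC t * RtoC (/ 2))%C by (rewrite !RtoC_mult; ring).
replace (RtoC (eps * a * (eps * a) * / 2)) with (RtoC (eps * a) * RtoC (eps * a) * RtoC (/ 2))%C
  by (rewrite !RtoC_mult; ring).
replace (RtoC ((eps * a + t) * (eps * a + t) * / 2)) with
  ((RtoC (eps * a) + RtoC t) * (RtoC (eps * a) + RtoC t) * RtoC (/ 2))%C
  by (rewrite <- RtoC_plus, !RtoC_mult; ring).
rewrite (RtoC_plus (eps * a) t).
assert (E2 : (RtoC 1 = RtoC (/ 2) + RtoC (/ 2))%C) by (rewrite <- RtoC_plus; f_equal; field).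
rewrite E2; ring.
Qed.

(** In [smooth_window] the variable [t] occurs only in an exponential and in the ends of the window.
    The fundamental theorem of calculus therefore gives the derivative with no differentiability of
    [F]: the ends contribute the translation by [eps] and, with a minus sign, [F] itself. *)
Lemma dirder_smooth (F : C -> C) eps : eps <> 0 -> cts (U := C_U) (V := C_U) F ->
  dirder eta (smooth l eta eps F) (fun z => RtoC l * (eta * Cconj z) * smooth l eta eps F z
    + RtoC (/ eps) * (transl l eta eps F z - F z))%C.
Proof.
intros He HF z.
assert (HT : cts (fun b => transl l eta b F z)).
{ apply (cts_transl (fun b => b) (fun _ => F)); cts_tac. }
eapply cder_ext; [intros t; symmetry; apply smooth_window; assumption|].
assert (Ht : cder (fun s => RtoC s) 0 (RtoC 1)) by (apply (cder_RtoC (fun s => s)); auto_derive; trivial).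
assert (Ht2 : cder (fun s => RtoC (s * s * / 2)) 0 (RtoC 0)).
{ apply (cder_RtoC (fun s => s * s * / 2)); auto_derive; trivial; field. }
eapply cder_eq; [|apply cder_mult;
 [ apply cder_Cexp, cder_scal, cder_plus; [|exact Ht2];
   apply (cder_mult (fun s => RtoC s * eta)%C); [|apply cder_const];
   apply (cder_mult (fun s => RtoC s)); [exact Ht | apply cder_const]
 | apply cder_scal, cder_plus;
   [ apply (cder_comp (fun s => cint (fun b => transl l eta b F z) 0 s) (fun s => s + eps));
     [apply cder_cint, HT | auto_derive; [trivial|reflexivity]]
   | apply (cder_ext (fun s => - RtoC 1 * cint (fun b => transl l eta b F z) 0 s)%C);
      [intros s; ring | apply cder_scal, cder_cint, HT] ] ] ].
simpl.
assert (E := smooth_window F eps z 0 He HF).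
replace (z + RtoC 0 * eta)%C with z in E by ring.
rewrite E, transl_0.
replace (RtoC l * (RtoC 0 * eta * Cconj z + RtoC (0 * 0 * / 2)))%C with (RtoC 0)
  by (replace (0 * 0 * / 2) with 0 by field; ring).
rewrite Cexp_0, Rplus_0_l; ring.
Qed.

End Smoothing.

(** * The Cauchy-Riemann operator and the angular moments *)

Lemma Ci_unit : (Ci * Cconj Ci = RtoC 1)%C.
Proof. apply injective_projections; simpl; ring. Qed.

Lemma RtoC_1_unit : (RtoC 1 * Cconj (RtoC 1) = RtoC 1)%C.
Proof. apply injective_projections; simpl; ring. Qed.

Lemma cder_line (z eta : C) t : cder (fun t => z + RtoC t * eta)%C t eta.
Proof.
apply cder_eq with (RtoC 0 + (RtoC 1 * eta + RtoC t * RtoC 0))%C; [ring|].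
apply cder_plus; [apply cder_const|].
apply (cder_mult (fun t => RtoC t)); [|apply cder_const].
apply (cder_RtoC (fun s => s)); auto_derive; trivial.
Qed.

Lemma cder_Cconj (f : R -> C) t l : cder f t l -> cder (fun s => Cconj (f s)) t (Cconj l).
Proof.
intros [H1 H2]; split; [exact H1|].
exact (is_derive_opp (V := R_NormedModule) _ _ _ H2).
Qed.

Record C1 (G Gx Gy : C -> C) : Prop := {
  C1_cts : cts (U := C_U) (V := C_U) G;
  C1_cts_x : cts (U := C_U) (V := C_U) Gx;
  C1_cts_y : cts (U := C_U) (V := C_U) Gy;
  C1_dir_x : dirder (RtoC 1) G Gx;
  C1_dir_y : dirder Ci G Gy }.

(** The derivative along [zeta] of the average along [eta], taken under the integral sign; the
    second term comes from [conj(z)] in the exponent of [transl]. *)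
Definition smooth_dir (l : R) (eta zeta : C) (eps : R) (H H' : C -> C) (z : C) : C :=
  cint (fun a => transl l eta (eps * a) H' z
    + - RtoC l * (RtoC (eps * a) * eta * Cconj zeta) * transl l eta (eps * a) H z)%C 0 1.

Lemma cts_smooth_dir (l : R) (eta zeta : C) eps (H H' : C -> C) :
  cts (U := C_U) (V := C_U) H -> cts (U := C_U) (V := C_U) H' ->
  cts (U := C_U) (V := C_U) (smooth_dir l eta zeta eps H H').
Proof.
intros HH HH'; apply (cts_cint (U := C_U)); [lra|].
assert (K : forall F, cts (U := C_U) (V := C_U) F ->
   cts (U := prod_UniformSpace C_U R_U) (V := C_U)
    (fun p => transl l eta (eps * snd p) F (fst p))).
{ intros F HF; apply (cts_transl l eta (U := prod_UniformSpace C_U R_U)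
  (fun p => eps * snd p) (fun _ => F)); cts_tac. }
apply cts_Cplus; [apply K, HH'|]; apply cts_Cmult; [cts_tac | apply K, HH].
Qed.

Lemma dirder_smooth_dir (l : R) (eta zeta : C) eps (H H' : C -> C) :
  cts (U := C_U) (V := C_U) H -> cts (U := C_U) (V := C_U) H' -> dirder zeta H H' ->
  dirder zeta (smooth l eta eps H) (smooth_dir l eta zeta eps H H').
Proof.
intros HH HH' HD z.
set (g := fun t a => transl l eta (eps * a) H (z + RtoC t * zeta)%C).
set (g' := fun t a => (transl l eta (eps * a) H' (z + RtoC t * zeta)%C
    + - RtoC l * (RtoC (eps * a) * eta * Cconj zeta) * transl l eta (eps * a) H (z + RtoC t * zeta))%C).
apply cder_eq with (cint (g' 0) 0 1).
{ unfold g', smooth_dir; replace (z + RtoC 0 * zeta)%C with z by ring; reflexivity. }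
apply (cder_cint_param g g').
- intros t a; unfold g, g', transl.
  eapply cder_eq; [|apply cder_mult].
  2: { eapply cder_ext; [|exact (dirder_at zeta H H' (z + RtoC (eps * a) * eta)%C t HD)].
       intros s; simpl; f_equal; ring. }
  2: { apply cder_Cexp, cder_scal, cder_plus; [|apply cder_const].
       apply cder_scal, cder_Cconj, cder_line. }
  simpl; replace (z + RtoC (eps * a) * eta + RtoC t * zeta)%C
    with (z + RtoC t * zeta + RtoC (eps * a) * eta)%C by ring; ring.
- intros t; apply (cts_transl l eta (fun a => eps * a) (fun _ => H)); cts_tac.
- assert (K : forall F, cts (U := C_U) (V := C_U) F ->
   cts (U := prod_UniformSpace R_U R_U) (V := C_U)
    (fun p => transl l eta (eps * snd p) F (z + RtoC (fst p) * zeta)%C)).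
  { intros F HF; apply (cts_transl l eta (U := prod_UniformSpace R_U R_U)
     (fun p => eps * snd p) (fun _ => F)); cts_tac. }
  unfold g'; apply cts_Cplus; [apply K, HH'|]; apply cts_Cmult; [cts_tac | apply K, HH].
Qed.

(** Averaging along [Ci] creates the derivative in that direction; averaging along [1] then creates
    the other one and keeps the first, by differentiation under the integral. *)
Lemma smooth_C1 (l eps : R) (F : C -> C) : eps <> 0 -> cts (U := C_U) (V := C_U) F ->
  exists Gx Gy, C1 (smooth l (RtoC 1) eps (smooth l Ci eps F)) Gx Gy.
Proof.
intros He HF.
assert (HH := cts_smooth_const l Ci F eps HF).
assert (HD := dirder_smooth l Ci Ci_unit F eps He HF).
set (H := smooth l Ci eps F) in *.
assert (HG := cts_smooth_const l (RtoC 1) H eps HH).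
assert (K : forall eta F, cts (U := C_U) (V := C_U) F ->
   cts (U := C_U) (V := C_U) (transl l eta eps F)).
{ intros eta F' HF'; apply (cts_transl l eta (U := C_U) (fun p => eps) (fun _ => F') (fun z => z)); cts_tac. }
assert (HH' : cts (U := C_U) (V := C_U) (fun z => (RtoC l * (Ci * Cconj z) * H z
        + RtoC (/ eps) * (transl l Ci eps F z - F z))%C)).
{ assert (K1 := K Ci F HF); cts_tac. }
do 2 eexists; split.
- exact HG.
- assert (K1 := K (RtoC 1) H HH).
  assert (K2 : cts (U := C_U) (V := C_U) (fun z => (RtoC l * (RtoC 1 * Cconj z) * smooth l (RtoC 1) eps H z
        + RtoC (/ eps) * (transl l (RtoC 1) eps H z - H z))%C)) by cts_tac.
  exact K2.
- apply (cts_smooth_dir l (RtoC 1) Ci eps H _ HH HH').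
- apply dirder_smooth; [apply RtoC_1_unit | assumption | assumption].
- apply dirder_smooth_dir; assumption.
Qed.

Lemma kmean_dir (l s : R) (eta : C) (G G' : C -> C) z :
  cts (U := C_U) (V := C_U) G -> cts (U := C_U) (V := C_U) G' -> dirder eta G G' ->
  cder (fun t => kmean l G s (z + RtoC t * eta)) 0
    (cint (fun t => (G' (z - circ s t) + RtoC l * eta * Cconj (circ s t) * G (z - circ s t))
       * Cexp (RtoC l * (z * Cconj (circ s t)))) 0 (2 * PI))%C.
Proof.
intros HG HG' HD.
set (g := fun u t => (G (z - circ s t + RtoC u * eta)
   * Cexp (RtoC l * ((z + RtoC u * eta) * Cconj (circ s t))))%C).
set (g' := fun u t => ((G' (z - circ s t + RtoC u * eta) + RtoC l * eta * Cconj (circ s t) * G (z - circ s t + RtoC u * eta))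
       * Cexp (RtoC l * ((z + RtoC u * eta) * Cconj (circ s t))))%C).
apply cder_ext with (fun u => cint (g u) 0 (2 * PI)).
{ intros u; apply cint_ext; intros t; unfold g; do 2 f_equal; ring. }
eapply cder_eq; [|apply (cder_cint_param g g')].
- apply cint_ext; intros t; unfold g'.
  replace (z - circ s t + RtoC 0 * eta)%C with (z - circ s t)%C by ring.
  replace (z + RtoC 0 * eta)%C with z by ring; reflexivity.
- intros u t; unfold g, g'.
  eapply cder_eq; [|apply cder_mult].
  2: exact (dirder_at eta G G' (z - circ s t)%C u HD).
  2: { apply cder_Cexp, cder_scal, (cder_mult _ (fun _ => Cconj (circ s t)));
       [apply cder_line | apply cder_const]. }
  simpl; ring.
- intros u; unfold g; cts_tac.
- unfold g'; cts_tac.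
Qed.

(** For fixed [s] the condition [r + Cmod z < s] is open in [z], so both directional derivatives of
    the mean vanish. In [d_x + i d_y] the contributions of the kernel cancel because
    [1 + i * i = 0]: the kernel is holomorphic in [z]. *)
Lemma kmean_vanish_dbar (l r : R) (G Gx Gy : C -> C) : C1 G Gx Gy ->
  kmean_vanish l r G -> kmean_vanish l r (fun z => Gx z + Ci * Gy z)%C.
Proof.
intros [HG HGx HGy HDx HDy] H z s Hs.
assert (H0 : forall eta, Cmod eta = 1 -> locally 0 (fun t => kmean l G s (z + RtoC t * eta)%C = RtoC 0)).
{ intros eta Heta.
  assert (Hd : 0 < s - (r + Cmod z)) by lra.
  exists (mkposreal _ Hd); intros t Ht.
  apply H; assert (H1 := Cmod_triangle z (RtoC t * eta)%C).
  rewrite Cmod_mult, Heta, Cmod_R in H1.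
  assert (Ht' : Rabs (t - 0) < s - (r + Cmod z)) by exact Ht.
  rewrite Rminus_0_r in Ht'; lra. }
assert (Z : forall eta G', Cmod eta = 1 -> cts (U := C_U) (V := C_U) G' -> dirder eta G G' ->
  cint (fun t => (G' (z - circ s t) + RtoC l * eta * Cconj (circ s t) * G (z - circ s t))
       * Cexp (RtoC l * (z * Cconj (circ s t))))%C 0 (2 * PI) = RtoC 0).
{ intros eta G' Heta HG' HD.
  eapply cder_unique; [apply kmean_dir; assumption|].
  apply cder_ext_loc with (fun _ => RtoC 0); [|apply cder_const].
  generalize (H0 eta Heta); apply filter_imp; intros t E; symmetry; exact E. }
assert (Zx := Z (RtoC 1) Gx Cmod_1 HGx HDx).
assert (Zy := Z Ci Gy (Cmod_eta Ci Ci_unit) HGy HDy).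
transitivity (RtoC 0 + Ci * RtoC 0)%C; [|ring].
rewrite <- Zx at 1; rewrite <- Zy.
rewrite <- cint_scal, <- cint_plus by cts_tac.
apply cint_ext; intros t.
assert (E : (Ci * Ci = - RtoC 1)%C) by (apply injective_projections; simpl; ring).
match goal with |- (?a * ?e = ?b * ?e + Ci * ((?c + RtoC l * Ci * ?d * ?g) * ?e))%C =>
  transitivity ((b + Ci * c + (Ci * Ci) * RtoC l * d * g) * e)%C; [rewrite E; ring | ring] end.
Qed.

(** * Circle integrals and moments *)

Lemma cder_circ_r (r t : R) : cder (fun s => circ s t) r (cos t, sin t).
Proof.
apply cder_ext with (fun s => (s * cos t, s * sin t)); [intros s; symmetry; apply circ_eq|].
split; simpl; auto_derive; trivial; ring.
Qed.

Lemma cder_circ_t (r t : R) : cder (fun t => circ r t) t (- (r * sin t), r * cos t).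
Proof.
apply cder_ext with (fun t => (r * cos t, r * sin t)); [intros s; symmetry; apply circ_eq|].
split; simpl; auto_derive; trivial; ring.
Qed.

(* In polar coordinates [d_x + i d_y = e^(i t) (d_r + (i / r) d_t)], and the
   [d_t] part integrates to zero over a circle. *)
Lemma cder_circle_integral (G Gx Gy : C -> C) r : C1 G Gx Gy -> r <> 0 ->
  cder (fun r => cint (fun t => G (circ r t)) 0 (2 * PI)) r
    (cint (fun t => Cconj (circ 1 t) * (Gx (circ r t) + Ci * Gy (circ r t)))%C 0 (2 * PI)).
Proof.
intros [HG HGx HGy HDx HDy] Hr.
set (gr := fun r t => (RtoC (cos t) * Gx (circ r t) + RtoC (sin t) * Gy (circ r t))%C).
set (gt := fun t => (RtoC (- (r * sin t)) * Gx (circ r t) + RtoC (r * cos t) * Gy (circ r t))%C).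
assert (Ht : cint gt 0 (2 * PI) = RtoC 0).
{ rewrite (cint_cder (fun t => G (circ r t)) gt).
  - rewrite !circ_eq, cos_2PI, sin_2PI, cos_0, sin_0; ring.
  - intros t; exact (cder_curve G Gx Gy HDx HDy HGx (fun t => circ r t) t _ (cder_circ_t r t)).
  - unfold gt; cts_tac. }
apply cder_eq with (cint (gr r) 0 (2 * PI)).
- transitivity (cint (gr r) 0 (2 * PI) + Ci * RtoC (/ r) * cint gt 0 (2 * PI))%C;
    [rewrite Ht; ring|].
  rewrite <- cint_scal, <- cint_plus by (unfold gr, gt; cts_tac).
  apply cint_ext; intros t; unfold gr, gt; rewrite (circ_eq 1 t).
  destruct (Gx (circ r t)) as [a b]; destruct (Gy (circ r t)) as [c d].
  apply injective_projections; simpl; field; exact Hr.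
- apply (cder_cint_param (fun r t => G (circ r t)) gr).
  + intros s t; exact (cder_curve G Gx Gy HDx HDy HGx (fun s => circ s t) s _ (cder_circ_r s t)).
  + intros s; cts_tac.
  + unfold gr; cts_tac.
Qed.

Lemma dirder_mult_id (eta : C) (G G' : C -> C) : dirder eta G G' ->
  dirder eta (fun z => G z * z)%C (fun z => G' z * z + eta * G z)%C.
Proof.
intros HD z; eapply cder_eq; [|exact (cder_mult _ _ _ _ _ (HD z) (cder_line z eta 0))].
simpl; replace (z + RtoC 0 * eta)%C with z by ring; ring.
Qed.

Lemma dirder_ext (eta : C) (F G F' G' : C -> C) : (forall z, F z = G z) ->
  (forall z, F' z = G' z) -> dirder eta F F' -> dirder eta G G'.
Proof.
intros E E' HD z; rewrite <- E'; eapply cder_ext; [|apply HD].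
intros t; apply E.
Qed.

(** The powers of [z] are holomorphic, so [d_x + i d_y] passes over them; each further factor [z]
    contributes [(1 + i * i) G z^k = 0]. *)
Lemma C1_mult_pow (G Gx Gy : C -> C) k : C1 G Gx Gy ->
  exists Hx Hy, C1 (fun z => G z * z ^ k)%C Hx Hy /\
    forall z, (Hx z + Ci * Hy z = (Gx z + Ci * Gy z) * z ^ k)%C.
Proof.
intros H; induction k as [|k [Hx [Hy [[HG HGx HGy HDx HDy] E]]]].
- exists Gx, Gy; split; [|intros z; simpl; ring].
  destruct H as [HG HGx HGy HDx HDy]; split; try assumption.
  + apply (cts_Cmult G (fun z => z ^ 0)%C); cts_tac.
  + apply (dirder_ext _ G _ Gx); [intros z; simpl; ring | reflexivity | exact HDx].
  + apply (dirder_ext _ G _ Gy); [intros z; simpl; ring | reflexivity | exact HDy].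
- exists (fun z => Hx z * z + RtoC 1 * (G z * z ^ k))%C, (fun z => Hy z * z + Ci * (G z * z ^ k))%C; split.
  + assert (HG0 := C1_cts _ _ _ H).
    split; try (cts_tac; fail);
      (eapply dirder_ext; [| |apply dirder_mult_id; (exact HDx || exact HDy)]);
      intros z; simpl; ring.
  + intros z; simpl.
    assert (E2 : (Ci * Ci = - RtoC 1)%C) by (apply injective_projections; simpl; ring).
    transitivity ((Hx z + Ci * Hy z) * z + (RtoC 1 + Ci * Ci) * (G z * z ^ k))%C; [ring|].
    rewrite E, E2; ring.
Qed.

(** The weight is the power of the point, not of [e^(i t)]: being holomorphic, it commutes with the
    Cauchy-Riemann operator. *)
Definition mom (k : nat) (F : C -> C) (r : R) : C :=
  cint (fun t => F (circ r t) * circ r t ^ k)%C 0 (2 * PI).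

(** The factor [e^(- i t)] in [cder_circle_integral] turns the weight [z^(k+1)] into [r z^k], which
    lowers the order by one. *)
Lemma cder_mom (G Gx Gy : C -> C) k r : C1 G Gx Gy -> r <> 0 ->
  cder (mom (S k) G) r (RtoC r * mom k (fun z => Gx z + Ci * Gy z)%C r)%C.
Proof.
intros H Hr; destruct (C1_mult_pow G Gx Gy (S k) H) as [Hx [Hy [HC E]]].
eapply cder_eq; [|exact (cder_circle_integral _ Hx Hy r HC Hr)].
destruct H as [HG HGx HGy _ _].
unfold mom; rewrite <- cint_scal by cts_tac.
apply cint_ext; intros t; rewrite E.
transitivity ((Gx (circ r t) + Ci * Gy (circ r t)) * (circ r t ^ k) * (Cconj (circ 1 t) * circ r t))%C;
  [rewrite Cpow_S; ring|].
assert (E1 : (Cconj (circ 1 t) * circ r t = RtoC r)%C).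
{ rewrite !circ_eq; assert (T := sin2_cos2 t); unfold Rsqr in T.
  apply injective_projections; simpl; [|ring].
  transitivity (r * (sin t * sin t + cos t * cos t)); [ring | rewrite T; ring]. }
rewrite E1; ring.
Qed.

(** * Polynomials of bounded degree *)

(** Horner form. The bound on the degree is part of the predicate because closure under pointwise
    limits rests on it; [k = 0] is the zero function. *)
Fixpoint poly_lt (k : nat) (p : R -> R) : Prop :=
  match k with
  | O => forall x, p x = 0
  | S k => exists c q, poly_lt k q /\ forall x, p x = c + x * q x
  end.

Lemma poly_lt_S k p : poly_lt k p -> poly_lt (S k) p.
Proof.
revert p; induction k as [|k IH]; intros p H.
  exists 0, (fun _ => 0); split; [intros ?; reflexivity | intros x; rewrite H; ring].
destruct H as [c [q [Hq E]]]; exists c, q; split; [apply IH, Hq | exact E].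
Qed.

Lemma poly_lt_lin k a b p q : poly_lt k p -> poly_lt k q ->
  poly_lt k (fun x => a * p x + b * q x).
Proof.
revert p q; induction k as [|k IH]; intros p q Hp Hq.
  intros x; rewrite Hp, Hq; ring.
destruct Hp as [c [p' [Hp E]]]; destruct Hq as [d [q' [Hq E']]].
exists (a * c + b * d), (fun x => a * p' x + b * q' x); split; [apply IH; assumption|].
intros x; rewrite E, E'; ring.
Qed.

Lemma poly_lt_ext k p q : (forall x, p x = q x) -> poly_lt k p -> poly_lt k q.
Proof.
destruct k as [|k]; intros E H; [intros x; rewrite <- E; apply H|].
destruct H as [c [p' [Hp H]]]; exists c, p'; split; [exact Hp | intros x; rewrite <- E; apply H].
Qed.

Lemma poly_lt_factor k p a : poly_lt (S k) p ->
  exists q, poly_lt k q /\ forall x, p x = p a + (x - a) * q x.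
Proof.
revert p; induction k as [|k IH]; intros p [c [q [Hq E]]].
  exists (fun _ => 0); split; [intros ?; reflexivity|].
  intros x; rewrite !E, !Hq; ring.
destruct (IH q Hq) as [q' [Hq' E']].
exists (fun x => q a + x * q' x); split.
  exists (q a), q'; split; [exact Hq' | reflexivity].
intros x; rewrite !E, E'; ring.
Qed.

Lemma poly_lt_newton k q a c : poly_lt k q -> poly_lt (S k) (fun x => c + (x - a) * q x).
Proof.
intros Hq.
apply poly_lt_ext with (fun x => 1 * (c + x * q x) + (- a) * q x); [intros x; ring|].
apply poly_lt_lin; [|apply poly_lt_S, Hq].
exists c, q; split; [exact Hq | reflexivity].
Qed.

Lemma poly_lt_antiderivative k p : poly_lt k p ->
  exists q, poly_lt k q /\ forall x, is_derive (fun x => x * q x) x (p x).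
Proof.
(* The factor [x ^ n] makes the induction go through: the Horner step
   [x^n (c + x p') = c x^n + x^(n+1) p'] raises [n]. *)
assert (H : forall k p, poly_lt k p -> forall n, exists q, poly_lt k q /\
  forall x, is_derive (fun x => x ^ S n * q x) x (x ^ n * p x)).
{ clear k p; induction k as [|k IH]; intros p Hp n.
  - exists (fun _ => 0); split; [intros ?; reflexivity|].
    intros x; rewrite Hp, Rmult_0_r.
    apply is_derive_ext with (fun _ => 0); [intros t; symmetry; apply Rmult_0_r|].
    exact (is_derive_const (V := R_NormedModule) 0 x).
  - destruct Hp as [c [p' [Hp E]]]; destruct (IH p' Hp (S n)) as [q [Hq Hd]].
    exists (fun x => c / INR (S n) + x * q x); split.
      exists (c / INR (S n)), q; split; [exact Hq | reflexivity].
    intros x.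
    apply is_derive_ext with (fun x => c / INR (S n) * x ^ S n + x ^ S (S n) * q x).
      intros t; simpl; ring.
    replace (x ^ n * p x) with (c * x ^ n + x ^ S n * p' x) by (rewrite E; simpl; ring).
    apply (is_derive_plus (V := R_NormedModule)); [|apply Hd].
    assert (Hn : INR (S n) <> 0) by (apply not_0_INR; discriminate).
    auto_derive; [trivial|].
    change (match n with O => 1 | S _ => INR n + 1 end) with (INR (S n)).
    field; exact Hn. }
intros Hp; destruct (H k p Hp O) as [q [Hq Hd]]; exists q; split; [exact Hq|].
intros x; replace (p x) with (x ^ 0 * p x) by (simpl; ring).
apply is_derive_ext with (fun x => x ^ 1 * q x); [intros t; simpl; ring | apply Hd].
Qed.

(** Division by [x - a] at a point [a] of [S] lowers the degree: the quotients [q n] converge to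
    [(A x - A a) / (x - a)] on [S] without [a], a set that is still unbounded. *)
Lemma poly_lt_lim_seq k (S : R -> Prop) (p : nat -> R -> R) (A : R -> R) :
  (forall x, exists y, x < y /\ S y) -> (forall n, poly_lt k (p n)) ->
  (forall x, S x -> is_lim_seq (fun n => p n x) (A x)) ->
  exists q, poly_lt k q /\ forall x, S x -> A x = q x.
Proof.
revert S p A; induction k as [|k IH]; intros S p A HS Hp Hl.
{ exists (fun _ => 0); split; [intros ?; reflexivity|]; intros x Hx.
  assert (Hl' := is_lim_seq_unique _ _ (Hl x Hx)).
  rewrite (Lim_seq_ext _ (fun _ => 0)) in Hl' by (intros n; apply (Hp n)).
  rewrite Lim_seq_const in Hl'; injection Hl'; intros E; symmetry; exact E. }
destruct (HS 0) as [a [_ Ha]].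
set (q := fun n => proj1_sig (constructive_indefinite_description _ (poly_lt_factor k (p n) a (Hp n)))).
assert (Hq : forall n, poly_lt k (q n) /\ forall x, p n x = p n a + (x - a) * q n x).
{ intros n; exact (proj2_sig (constructive_indefinite_description _ (poly_lt_factor k (p n) a (Hp n)))). }
destruct (IH (fun x => S x /\ x <> a) q (fun x => (A x - A a) / (x - a))) as [b [Hb E]].
- intros x; destruct (HS (Rmax x a)) as [y [Hy HSy]].
  assert (H1 := Rmax_l x a); assert (H2 := Rmax_r x a).
  exists y; repeat split; [lra | exact HSy | lra].
- intros n; apply Hq.
- intros x [Hx Hxa].
  apply is_lim_seq_ext with (fun n => (p n x - p n a) * / (x - a)).
    intros n; rewrite (proj2 (Hq n) x); field; lra.
  apply (is_lim_seq_scal_r _ (/ (x - a)) (A x - A a)).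
  apply is_lim_seq_minus'; apply Hl; assumption.
- exists (fun x => A a + (x - a) * b x); split; [apply poly_lt_newton, Hb|].
  intros x Hx; destruct (Req_dec x a) as [->|Hxa]; [ring|].
  rewrite <- E by (split; assumption); field; lra.
Qed.

(** Half of the exponential absorbs the factor [x] of the Horner form and the other half goes to the
    induction hypothesis, so the rate [a] stays general. *)
Lemma poly_lt_exp_decay k p : poly_lt k p ->
  forall a, 0 < a -> is_lim (fun x => exp (- (a * x)) * p x) p_infty 0.
Proof.
assert (He : forall a, 0 < a -> is_lim (fun x => exp (- (a * x))) p_infty 0).
{ intros a Ha; apply (is_lim_comp exp (fun x => - (a * x)) p_infty 0 m_infty).
  - apply is_lim_exp_m.
  - assert (E : m_infty = Rbar_opp (Rbar_mult a p_infty)).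
      simpl; destruct (Rle_dec 0 a) as [H|H]; [|lra].
      destruct (Rle_lt_or_eq_dec 0 a H); [reflexivity | lra].
    rewrite E; apply is_lim_opp, is_lim_scal_l, is_lim_id.
  - exists 0; intros y _; discriminate. }
revert p; induction k as [|k IH]; intros p Hp a Ha.
  apply is_lim_ext with (fun _ => 0); [intros x; rewrite Hp; ring | apply is_lim_const].
destruct Hp as [c [q [Hq E]]].
(* The rate is halved once more: [exp (a / 4 * x) >= a / 4 * x] bounds [exp (- (a / 4 * x)) * x] by
   [/ (a / 4)]. *)
assert (Hx : is_lim (fun x => exp (- (a / 2 * x)) * x) p_infty 0).
{ assert (H4 : is_lim (fun x => exp (- (a / 4 * x)) * / (a / 4)) p_infty 0).
  { replace (Finite 0) with (Rbar_mult 0 (/ (a / 4))) by (simpl; f_equal; ring).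
    apply is_lim_scal_r, He; lra. }
  apply (is_lim_le_le_loc (fun _ => 0) (fun x => exp (- (a / 4 * x)) * / (a / 4)));
    [|apply is_lim_const | exact H4].
  exists 0; intros x Hx; split.
    apply Rmult_le_pos; [left; apply exp_pos | lra].
  replace (- (a / 2 * x)) with (- (a / 4 * x) + - (a / 4 * x)) by field.
  rewrite exp_plus, Rmult_assoc; apply Rmult_le_compat_l; [left; apply exp_pos|].
  rewrite exp_Ropp; assert (H := exp_ineq1_le (a / 4 * x)); assert (H' := exp_pos (a / 4 * x)).
  apply Rmult_le_reg_l with (exp (a / 4 * x) * (a / 4)); [apply Rmult_lt_0_compat; lra|].
  field_simplify; [|lra|lra]; lra. }
apply is_lim_ext with (fun x => exp (- (a * x)) * c + (exp (- (a / 2 * x)) * x) * (exp (- (a / 2 * x)) * q x)).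
{ intros x; rewrite E; replace (- (a * x)) with (- (a / 2 * x) + - (a / 2 * x)) by field.
  rewrite exp_plus; ring. }
assert (H1 : is_lim (fun x => exp (- (a * x)) * c) p_infty 0).
{ replace (Finite 0) with (Rbar_mult 0 c) by (simpl; f_equal; ring).
  apply is_lim_scal_r, He, Ha. }
assert (H2 := is_lim_mult _ _ _ _ _ Hx (IH q Hq (a / 2) ltac:(lra)) I).
assert (H3 := is_lim_plus' _ _ _ _ _ H1 H2).
replace (Finite 0) with (Finite (0 + 0 * 0)) by (f_equal; ring); exact H3.
Qed.

(** With [p x = c + x q x], the quotient [(p x - c) / x = q x] tends to 0 as well, so [q = 0] by
    induction and the constant [c] equals the limit 0. *)
Lemma poly_lt_lim0 k p : poly_lt k p -> is_lim p p_infty 0 -> forall x, p x = 0.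
Proof.
revert p; induction k as [|k IH]; intros p Hp Hl; [exact Hp|].
destruct Hp as [c [q [Hq E]]].
assert (H0 : forall x, q x = 0).
{ apply IH; [exact Hq|].
  apply is_lim_ext_loc with (fun x => (p x - c) * / x).
    exists 0; intros x Hx; rewrite E; field; lra.
  assert (H1 : is_lim (fun x => p x - c) p_infty (0 - c)).
  { apply is_lim_minus'; [exact Hl | apply is_lim_const]. }
  assert (H2 : is_lim (fun x => / x) p_infty 0).
  { apply (is_lim_inv (fun x => x) p_infty p_infty); [apply is_lim_id | discriminate]. }
  assert (H3 := is_lim_mult _ _ _ _ _ H1 H2 I).
  replace (Finite 0) with (Rbar_mult (0 - c) 0) by (simpl; f_equal; ring); exact H3. }
intros x; rewrite E, H0.
assert (H1 : is_lim (fun _ => c) p_infty 0).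
{ apply is_lim_ext with p; [intros y; rewrite E, H0; ring | exact Hl]. }
apply is_lim_unique in H1; rewrite Lim_const in H1; injection H1; intros ->; ring.
Qed.

Lemma exp_poly_vanish k p q c a : 0 < a -> poly_lt k p -> poly_lt k q ->
  (forall x, c < x -> q x = exp (- (a * x)) * p x) -> forall x, q x = 0.
Proof.
intros Ha Hp Hq E; apply (poly_lt_lim0 k); [exact Hq|].
apply is_lim_ext_loc with (fun x => exp (- (a * x)) * p x); [|apply (poly_lt_exp_decay k); assumption].
exists c; intros x Hx; symmetry; apply E, Hx.
Qed.

(** The function [x -> N (- x)] has derivative [x p(x^2)], and so does half of a primitive of [p]
    taken at [x^2]. Integration raises the degree bound by one, and the integration constant is the
    new constant term. *)
Lemma poly_lt_primitive_sqr k p (N : R -> R) R0 : 0 <= R0 -> poly_lt k p ->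
  (forall x, R0 < x -> is_derive N (- x) (- x * p (x * x))) ->
  exists q, poly_lt (S k) q /\ forall x, R0 < x -> N (- x) = q (x * x).
Proof.
intros HR Hp HN; destruct (poly_lt_antiderivative k p Hp) as [q [Hq Hd]].
set (D := fun x => N (- x) - / 2 * (x * x * q (x * x))).
assert (HD : forall x, R0 < x -> is_derive D x 0).
{ intros x Hx; unfold D.
  replace 0 with (- 1 * (- x * p (x * x)) - / 2 * ((2 * x) * p (x * x))) by field.
  apply (is_derive_minus (V := R_NormedModule)).
    apply (is_derive_comp (V := R_NormedModule) N (fun x => - x)); [apply HN, Hx|].
    auto_derive; trivial; ring.
  apply is_derive_scal.
  apply (is_derive_comp (V := R_NormedModule) (fun y => y * q y) (fun x => x * x)); [apply Hd|].
  auto_derive; trivial; ring. }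
set (c := D (R0 + 1)).
exists (fun x => c + x * (/ 2 * q x)); split.
  exists c, (fun x => / 2 * q x); split; [|reflexivity].
  apply poly_lt_ext with (fun x => / 2 * q x + 0 * q x); [intros; ring|].
  apply poly_lt_lin; assumption.
intros x Hx.
assert (E : D x = c).
{ destruct (MVT_gen D (R0 + 1) x (fun _ => 0)) as [y [_ Hy]].
  - intros y Hy; apply HD.
    assert (R0 < Rmin (R0 + 1) x) by (apply Rmin_glb_lt; lra); lra.
  - intros y Hy; apply continuity_pt_filterlim, (ex_derive_continuous (V := R_NormedModule)).
    eexists; apply HD.
    assert (R0 < Rmin (R0 + 1) x) by (apply Rmin_glb_lt; lra); lra.
  - unfold c; lra. }
unfold D in E; lra.
Qed.

(** * The angular moments are polynomials *)

Lemma smooth_0 l eta F z : smooth l eta 0 F z = F z.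
Proof.
unfold smooth; transitivity (cint (fun _ => F z) 0 1).
  apply cint_ext; intros a; rewrite Rmult_0_l; apply transl_0.
rewrite cint_const, Rminus_0_r; ring.
Qed.

(** The moment of the twice averaged function is continuous in the averaging parameter, and at the
    value 0 it is the moment of [F]. *)
Lemma mom_smooth_lim l F k x (e : nat -> R) : cts (U := C_U) (V := C_U) F -> is_lim_seq e 0 ->
  is_lim_seq (fun n => fst (mom k (smooth l (RtoC 1) (e n) (smooth l Ci (e n) F)) x)) (fst (mom k F x)) /\
  is_lim_seq (fun n => snd (mom k (smooth l (RtoC 1) (e n) (smooth l Ci (e n) F)) x)) (snd (mom k F x)).
Proof.
intros HF He.
set (G := fun ep => smooth l (RtoC 1) ep (smooth l Ci ep F)).
assert (HG : cts (U := prod_UniformSpace R_U C_U) (V := C_U) (fun p => G (fst p) (snd p))).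
{ apply (cts_smooth l (RtoC 1) (fun ep => smooth l Ci ep F)).
  apply (cts_smooth l Ci (fun _ => F)), cts_const_param, HF. }
assert (HM : cts (V := C_U) (fun ep => mom k (G ep) x)).
{ apply (cts_cint (fun ep t => G ep (circ x t) * circ x t ^ k)%C 0 (2 * PI)).
    assert (H := PI_RGT_0); lra.
  apply cts_Cmult; [|cts_tac].
  apply (cts_comp (U := prod_UniformSpace R_U R_U) (fun p : prod_UniformSpace R_U C_U => G (fst p) (snd p))
    (fun p => (fst p, circ x (snd p))) HG).
  apply cts_pair; cts_tac. }
assert (E : mom k (G 0) x = mom k F x).
{ apply cint_ext; intros t; unfold G; rewrite !smooth_0; reflexivity. }
rewrite <- E; split.
  apply (filterlim_comp _ _ _ e (fun ep => fst (mom k (G ep) x)) _ _ _ He (cts_at _ (cts_Re _ HM) 0)).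
apply (filterlim_comp _ _ _ e (fun ep => snd (mom k (G ep) x)) _ _ _ He (cts_at _ (cts_Im _ HM) 0)).
Qed.

(** The inductive step for an abstract projection [pr], to serve both for real and imaginary parts.
    [G n] stands for the smoothed functions and [DG n] for their Cauchy-Riemann derivatives. *)
Lemma mom_poly_step (k : nat) (r : R) (F : C -> C) : 0 <= r ->
  forall (G DG : nat -> C -> C) (e : nat -> R),
  is_lim_seq e 0 -> (forall n, 0 <= e n) ->
  (forall n x, x <> 0 -> cder (mom (S k) (G n)) x (RtoC x * mom k (DG n) x)%C) ->
  forall pr : C -> R, (forall f t d, cder f t d -> is_derive (fun s => pr (f s)) t (pr d)) ->
  (forall a z, pr (RtoC a * z)%C = a * pr z) ->
  (forall x, is_lim_seq (fun n => pr (mom (S k) (G n) x)) (pr (mom (S k) F x))) ->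
  (forall n, exists p, poly_lt k p /\ forall x, r + e n < x -> pr (mom k (DG n) (- x)) = p (x * x)) ->
  exists p, poly_lt (S k) p /\ forall x, r < x -> pr (mom (S k) F (- x)) = p (x * x).
Proof.
intros Hr G DG e He He0 HD pr Hpr Hpr' HL Hp.
assert (H : forall n, exists q, poly_lt (S k) q /\
   forall x, r + e n < x -> pr (mom (S k) (G n) (- x)) = q (x * x)).
{ intros n; destruct (Hp n) as [p [Hp1 Hp2]]; specialize (He0 n).
  apply (poly_lt_primitive_sqr k p (fun x => pr (mom (S k) (G n) x)) (r + e n)); [lra | exact Hp1|].
  intros x Hx; rewrite <- Hp2, <- Hpr' by exact Hx.
  apply Hpr, HD; lra. }
set (q := fun n => proj1_sig (constructive_indefinite_description _ (H n))).
assert (Hq : forall n, poly_lt (S k) (q n) /\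
   forall x, r + e n < x -> pr (mom (S k) (G n) (- x)) = q n (x * x)).
{ intros n; exact (proj2_sig (constructive_indefinite_description _ (H n))). }
(* The limit is taken in the variable [x = rho^2], hence the set [r * r < x] and the radius
   [- sqrt x]. *)
destruct (poly_lt_lim_seq (S k) (fun x => r * r < x) q (fun x => pr (mom (S k) F (- sqrt x)))) as [p [Hp1 Hp2]].
- intros x; exists (Rmax x (r * r) + 1).
  assert (H1 := Rmax_l x (r * r)); assert (H2 := Rmax_r x (r * r)); lra.
- intros n; apply Hq.
(* For a given [x] the polynomial formula holds only once [e n < sqrt x - r]. *)
- intros x Hx; apply is_lim_seq_ext_loc with (fun n => pr (mom (S k) (G n) (- sqrt x))); [|apply HL].
  assert (Hs : 0 < sqrt x - r).
  { assert (r < sqrt x); [|lra].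
    rewrite <- (sqrt_square r) by exact Hr; apply sqrt_lt_1; nra. }
  generalize (proj2 (is_lim_seq_spec e 0) He (mkposreal _ Hs)); apply filter_imp.
  intros n Hn; simpl in Hn; rewrite Rminus_0_r in Hn; apply Rabs_def2 in Hn.
  rewrite (proj2 (Hq n)) by lra; rewrite sqrt_sqrt by nra; reflexivity.
- exists p; split; [exact Hp1|]; intros x Hx.
  rewrite <- Hp2 by nra; rewrite sqrt_square by lra; reflexivity.
Qed.

(* The radius is [- x] because [z - w = - w] at [z = 0]. *)
Lemma mom_poly (k : nat) (l r : R) (F : C -> C) : 0 <= r -> cts (U := C_U) (V := C_U) F ->
  kmean_vanish l r F ->
  (exists p, poly_lt k p /\ forall x, r < x -> fst (mom k F (- x)) = p (x * x)) /\
  (exists q, poly_lt k q /\ forall x, r < x -> snd (mom k F (- x)) = q (x * x)).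
Proof.
(* The induction hypothesis is applied to derivatives of smoothed functions, with larger radii, so
   [r] and [F] stay general. *)
revert r F; induction k as [|k IH]; intros r F Hr HF HV.
- assert (E : forall x, r < x -> mom 0 F (- x) = RtoC 0).
  { intros x Hx; rewrite <- (HV (RtoC 0) x) by (rewrite Cmod_0; lra).
    apply cint_ext; intros t.
    replace (RtoC l * (RtoC 0 * Cconj (circ x t)))%C with (RtoC 0) by ring.
    rewrite Cexp_0; change (circ (- x) t ^ 0)%C with (RtoC 1); do 2 f_equal.
    rewrite !circ_eq; apply injective_projections; simpl; ring. }
  split; exists (fun _ => 0); (split; [intros ?; reflexivity | intros x Hx; rewrite E by exact Hx; reflexivity]).
- set (e := fun n => / (INR n + 1)).
  assert (He0 : forall n, 0 < e n).
  { intros n; apply Rinv_0_lt_compat; assert (H := pos_INR n); lra. }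
  assert (He : is_lim_seq e 0).
  { apply (is_lim_seq_inv _ p_infty); [|discriminate].
    apply is_lim_seq_ext with (fun n => INR (S n)); [intros n; apply S_INR|].
    apply (is_lim_seq_incr_1 INR), is_lim_seq_INR. }
  set (G := fun n => smooth l (RtoC 1) (e n) (smooth l Ci (e n) F)).
  assert (HG : forall n, exists D : (C -> C) * (C -> C), C1 (G n) (fst D) (snd D)).
  { intros n; destruct (smooth_C1 l (e n) F) as [Gx [Gy H]]; [apply Rgt_not_eq, He0 | exact HF|].
    exists (Gx, Gy); exact H. }
  set (D := fun n => proj1_sig (constructive_indefinite_description _ (HG n))).
  assert (HD : forall n, C1 (G n) (fst (D n)) (snd (D n))).
  { intros n; exact (proj2_sig (constructive_indefinite_description _ (HG n))). }
  set (DG := fun n z => (fst (D n) z + Ci * snd (D n) z)%C).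
  (* Each of the two averagings, along [Ci] and along [1], costs [e n] in the radius. *)
  assert (HV' : forall n, kmean_vanish l (r + e n * 2) (DG n)).
  { intros n; apply (kmean_vanish_dbar l _ (G n)); [apply HD|].
    assert (H0 := He0 n); replace (r + e n * 2) with (r + e n + e n) by ring.
    apply (kmean_vanish_smooth l (RtoC 1) RtoC_1_unit (smooth l Ci (e n) F)); [lra | apply cts_smooth_const, HF|].
    apply (kmean_vanish_smooth l Ci Ci_unit F); [lra | exact HF | exact HV]. }
  assert (HI : forall n, _) by (intros n; assert (H0 := He0 n);
    refine (IH (r + e n * 2) (DG n) _ _ (HV' n)); [lra|];
    destruct (HD n) as [_ Hx Hy _ _]; unfold DG; cts_tac).
  assert (HL := fun x => mom_smooth_lim l F (S k) x e HF He).
  assert (He2 : is_lim_seq (fun n => e n * 2) 0).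
  { replace (Finite 0) with (Rbar_mult 0 2) by (simpl; f_equal; ring).
    apply is_lim_seq_scal_r, He. }
  assert (He2' : forall n, 0 <= e n * 2) by (intros n; assert (H0 := He0 n); lra).
  assert (HM : forall n x, x <> 0 -> cder (mom (S k) (G n)) x (RtoC x * mom k (DG n) x)%C).
  { intros n x Hx; apply cder_mom; [apply HD | exact Hx]. }
  split.
  + apply (mom_poly_step k r F Hr G DG (fun n => e n * 2) He2 He2' HM fst).
    * intros f t d H; apply H.
    * intros a z; simpl; ring.
    * intros x; exact (proj1 (HL x)).
    * intros n; exact (proj1 (HI n)).
  + apply (mom_poly_step k r F Hr G DG (fun n => e n * 2) He2 He2' HM snd).
    * intros f t d H; apply H.
    * intros a z; simpl; ring.
    * intros x; exact (proj2 (HL x)).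
    * intros n; exact (proj2 (HI n)).
Qed.

(** * From the gauged function back to [f] *)

Definition tint (l : R) (f : C -> C) (s : R) (z : C) : C :=
  cint (fun t => f (z - circ s t) * Cexp (Ci * RtoC l * RtoC (Im (z * Cconj (circ s t)))))%C 0 (2 * PI).

Definition gauge (l : R) (f : C -> C) (z : C) : C :=
  (f z * Cexp (RtoC (l / 2) * (z * Cconj z)))%C.

(** The expansion of [|z - w|^2] contributes [- l Re(z conj(w))], which cancels the real part of
    [l z conj(w)] and leaves the twisted phase. *)
Lemma gauge_exponent (l : R) (z w : C) :
  (RtoC (l / 2) * ((z - w) * Cconj (z - w)) + RtoC l * (z * Cconj w) =
   RtoC (l / 2) * (z * Cconj z + w * Cconj w) + Ci * RtoC l * RtoC (Im (z * Cconj w)))%C.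
Proof.
destruct z as [a b]; destruct w as [c d]; unfold Im.
apply injective_projections; simpl; field.
Qed.

Lemma kmean_gauge (l s : R) (f : C -> C) z : cts (U := C_U) (V := C_U) f ->
  kmean l (gauge l f) s z =
  (Cexp (RtoC (l / 2) * (z * Cconj z + RtoC (s * s))) * tint l f s z)%C.
Proof.
intros Hf; unfold kmean, tint; rewrite <- cint_scal by (unfold Im; cts_tac).
apply cint_ext; intros t; unfold gauge.
rewrite <- (circ_conj s t), <- Cmult_assoc, <- Cexp_plus, gauge_exponent, Cexp_plus; ring.
Qed.

Lemma mom_gauge (l x : R) (f : C -> C) k : cts (U := C_U) (V := C_U) f ->
  mom k (gauge l f) x = (RtoC (exp (l / 2 * (x * x))) * mom k f x)%C.
Proof.
intros Hf; unfold mom; rewrite <- cint_scal by cts_tac.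
apply cint_ext; intros t; unfold gauge.
rewrite circ_conj, <- RtoC_mult, Cexp_RtoC; ring.
Qed.

Definition tint_vanish (r : R) (f : C -> C) : Prop :=
  forall z s, r + Cmod z < s -> tint (/ 2) f s z = RtoC 0 /\ tint (- / 2) f s z = RtoC 0.

Lemma mom_vanish (r : R) (f : C -> C) k x : 0 <= r -> cts (U := C_U) (V := C_U) f ->
  tint_vanish r f -> r < x -> mom k f (- x) = RtoC 0.
Proof.
intros Hr Hf HV Hx.
assert (H1 : kmean_vanish (/ 2) r (gauge (/ 2) f)).
{ intros z s Hs; rewrite kmean_gauge, (proj1 (HV z s Hs)) by exact Hf; ring. }
assert (H2 : kmean_vanish (- / 2) r (gauge (- / 2) f)).
{ intros z s Hs; rewrite kmean_gauge, (proj2 (HV z s Hs)) by exact Hf; ring. }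
assert (Hg : forall l, cts (U := C_U) (V := C_U) (gauge l f)) by (intros l; unfold gauge; cts_tac).
destruct (mom_poly k _ r _ Hr (Hg _) H1) as [[p [Hp Ep]] [p' [Hp' Ep']]].
destruct (mom_poly k _ r _ Hr (Hg _) H2) as [[q [Hq Eq]] [q' [Hq' Eq']]].
assert (K : forall (pr : C -> R) u v, (forall a z, pr (RtoC a * z)%C = a * pr z) ->
  poly_lt k u -> poly_lt k v ->
  (forall x, r < x -> pr (mom k (gauge (/ 2) f) (- x)) = u (x * x)) ->
  (forall x, r < x -> pr (mom k (gauge (- / 2) f) (- x)) = v (x * x)) -> pr (mom k f (- x)) = 0).
{ intros pr u v Hpr Hu Hv Eu Ev.
  (* At [y = rho^2] the gauge factors are [exp (y / 4)] for [u] and [exp (- y / 4)] for [v]; their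
     quotient gives [v y = exp (- y / 2) * u y], hence the rate [/ 2]. *)
  assert (H0 : forall y, v y = 0).
  { apply (exp_poly_vanish k u v (r * r) (/ 2)); [lra | exact Hu | exact Hv|].
    intros y Hy.
    assert (Hs : r < sqrt y).
    { rewrite <- (sqrt_square r) by exact Hr; apply sqrt_lt_1; nra. }
    rewrite <- (sqrt_sqrt y) by nra.
    rewrite <- Eu, <- Ev by exact Hs.
    rewrite !mom_gauge, !Hpr by exact Hf.
    match goal with |- _ = exp ?u * (exp ?v * ?m) =>
      transitivity (exp u * exp v * m); [rewrite <- exp_plus; do 2 f_equal; field | ring] end. }
  specialize (Ev x Hx); rewrite H0, mom_gauge, Hpr in Ev by exact Hf.
  apply Rmult_integral in Ev; destruct Ev as [Ev|Ev]; [|exact Ev].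
  assert (H := exp_pos (- / 2 / 2 * (- x * - x))); lra. }
apply injective_projections.
  apply (K fst p q); try assumption; intros; simpl; ring.
apply (K snd p' q'); try assumption; intros; simpl; ring.
Qed.

Lemma cint_conj (g : R -> C) a b : cts (V := C_U) g ->
  cint (fun t => Cconj (g t)) a b = Cconj (cint g a b).
Proof.
intros Hg; apply injective_projections; simpl; [reflexivity|].
apply (RInt_opp (V := R_CompleteNormedModule)), ex_RInt_cts; cts_tac.
Qed.

Lemma Cexp_conj z : Cconj (Cexp z) = Cexp (Cconj z).
Proof.
unfold Cexp, Re, Im; simpl; rewrite cos_neg, sin_neg.
apply injective_projections; simpl; ring.
Qed.

Lemma tint_conj (l s : R) (f : C -> C) z : cts (U := C_U) (V := C_U) f ->
  tint l (fun w => Cconj (f w)) s z = Cconj (tint (- l) f s z).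
Proof.
intros Hf; unfold tint; rewrite <- cint_conj by (unfold Im; cts_tac).
apply cint_ext; intros t; rewrite Cmult_conj, Cexp_conj; do 2 f_equal.
apply injective_projections; simpl; ring.
Qed.

(** Conjugation changes the sign of the phase and so exchanges right and left means; the condition
    on both is therefore stable. *)
Lemma tint_vanish_conj r f : cts (U := C_U) (V := C_U) f -> tint_vanish r f ->
  tint_vanish r (fun w => Cconj (f w)).
Proof.
intros Hf H z s Hs; destruct (H z s Hs) as [H1 H2].
rewrite !tint_conj, H2 by exact Hf; rewrite Ropp_involutive, H1.
split; apply injective_projections; simpl; ring.
Qed.

(** * Uniqueness of Fourier series *)

(** Frequencies range over all integers so that [n - 1] is always available in
    [fourier_null_trig]. *)
Definition fourier_null (h : R -> R) : Prop := cts h /\ forall n : Z,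
  RInt (fun t => h t * cos (IZR n * t)) 0 (2 * PI) = 0 /\
  RInt (fun t => h t * sin (IZR n * t)) 0 (2 * PI) = 0.

Lemma RInt_lin2_null (f u v : R -> R) p q a b : cts u -> cts v ->
  (forall t, f t = p * u t + q * v t) -> RInt u a b = 0 -> RInt v a b = 0 -> RInt f a b = 0.
Proof.
intros Hu Hv E Eu Ev.
transitivity (RInt (fun t => p * u t + q * v t) a b); [apply RInt_ext; intros t _; apply E|].
rewrite RInt_lin2, Eu, Ev by assumption; change (p * 0 + q * 0 = 0 :> R); ring.
Qed.

Lemma fourier_null_lin a b h1 h2 : fourier_null h1 -> fourier_null h2 ->
  fourier_null (fun t => a * h1 t + b * h2 t).
Proof.
intros [C1 H1] [C2 H2]; split; [cts_tac|]; intros n.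
destruct (H1 n) as [H1c H1s]; destruct (H2 n) as [H2c H2s]; split.
  apply (RInt_lin2_null _ (fun t => h1 t * cos (IZR n * t)) (fun t => h2 t * cos (IZR n * t)) a b);
    [cts_tac | cts_tac | intros t; ring | assumption | assumption].
apply (RInt_lin2_null _ (fun t => h1 t * sin (IZR n * t)) (fun t => h2 t * sin (IZR n * t)) a b);
  [cts_tac | cts_tac | intros t; ring | assumption | assumption].
Qed.

(** By the product formulas, multiplication by [cos t] or [sin t] only mixes the coefficients of
    frequencies [n + 1] and [n - 1]. *)
Lemma fourier_null_trig h : fourier_null h ->
  fourier_null (fun t => h t * cos t) /\ fourier_null (fun t => h t * sin t).
Proof.
intros [C H].
assert (E : forall n t, IZR (n + 1) * t = IZR n * t + t) by (intros; rewrite plus_IZR; ring).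
assert (E' : forall n t, IZR (n - 1) * t = IZR n * t - t) by (intros; rewrite minus_IZR; ring).
split; (split; [cts_tac|]; intros n; destruct (H (n + 1)%Z) as [Hc Hs]; destruct (H (n - 1)%Z) as [Hc' Hs']; split).
- apply (RInt_lin2_null _ (fun t => h t * cos (IZR (n + 1) * t)) (fun t => h t * cos (IZR (n - 1) * t)) (/ 2) (/ 2));
    [cts_tac | cts_tac | intros t; rewrite E, E', cos_plus, cos_minus; field | assumption | assumption].
- apply (RInt_lin2_null _ (fun t => h t * sin (IZR (n + 1) * t)) (fun t => h t * sin (IZR (n - 1) * t)) (/ 2) (/ 2));
    [cts_tac | cts_tac | intros t; rewrite E, E', sin_plus, sin_minus; field | assumption | assumption].
- apply (RInt_lin2_null _ (fun t => h t * sin (IZR (n + 1) * t)) (fun t => h t * sin (IZR (n - 1) * t)) (/ 2) (- / 2));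
    [cts_tac | cts_tac | intros t; rewrite E, E', sin_plus, sin_minus; field | assumption | assumption].
- apply (RInt_lin2_null _ (fun t => h t * cos (IZR (n + 1) * t)) (fun t => h t * cos (IZR (n - 1) * t)) (- / 2) (/ 2));
    [cts_tac | cts_tac | intros t; rewrite E, E', cos_plus, cos_minus; field | assumption | assumption].
Qed.

Lemma fourier_null_ext h1 h2 : (forall t, h1 t = h2 t) -> fourier_null h1 -> fourier_null h2.
Proof.
intros E [C H]; split.
  constructor; intros t; apply continuous_ext with h1; [exact E | apply C].
intros n; destruct (H n) as [Hc Hs]; split.
  eapply eq_trans; [|exact Hc]; apply RInt_ext; intros; rewrite E; reflexivity.
eapply eq_trans; [|exact Hs]; apply RInt_ext; intros; rewrite E; reflexivity.
Qed.

Lemma fourier_null_RInt h : fourier_null h -> RInt h 0 (2 * PI) = 0.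
Proof.
intros [_ H]; eapply eq_trans; [|exact (proj1 (H 0%Z))]; apply RInt_ext; intros t _.
rewrite Rmult_0_l, cos_0; symmetry; apply Rmult_1_r.
Qed.

(** [a * (1 + cos (t - t0))] is a linear combination of [1], [cos t] and [sin t]. *)
Lemma fourier_null_kernel h a t0 n : fourier_null h ->
  fourier_null (fun t => h t * (a * (1 + cos (t - t0))) ^ n).
Proof.
intros H; induction n as [|n IH].
  apply (fourier_null_ext h); [intros; simpl; ring | exact H].
set (g := fun t => h t * (a * (1 + cos (t - t0))) ^ n) in *.
destruct (fourier_null_trig g IH) as [Hc Hs].
apply (fourier_null_ext (fun t => 1 * (a * g t + a * cos t0 * (g t * cos t)) + a * sin t0 * (g t * sin t))).
  intros t; unfold g; rewrite cos_minus; simpl; ring.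
apply fourier_null_lin; [apply fourier_null_lin|]; assumption.
Qed.

Lemma cos_le_away d y : 0 <= d <= PI -> d <= y <= 2 * PI - d -> cos y <= cos d.
Proof.
intros Hd Hy; destruct (Rle_dec y PI) as [H|H].
  apply cos_decr_1; lra.
replace (cos y) with (cos (2 * PI - y)).
  apply cos_decr_1; lra.
rewrite cos_minus, cos_2PI, sin_2PI; ring.
Qed.

Lemma RInt_ge_const (f : R -> R) a b m : a <= b -> cts f -> (forall t, a < t < b -> m <= f t) ->
  m * (b - a) <= RInt f a b.
Proof.
intros Hab Hf H.
replace (m * (b - a)) with (RInt (fun _ => m) a b).
  apply RInt_le; [exact Hab | apply ex_RInt_const | apply ex_RInt_cts, Hf | exact H].
rewrite (RInt_const (V := R_CompleteNormedModule)); unfold scal; simpl; unfold mult; simpl; ring.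
Qed.

(* The kernels [((1 + cos (t - t0)) / (1 + cos d)) ^ n] blow up near [t0] and stay
   bounded by [1] at distance at least [d] from it. *)
Lemma fourier_null_nonpos h t0 : fourier_null h -> 0 < t0 < 2 * PI -> h t0 <= 0.
Proof.
intros H Ht0; apply Rnot_lt_le; intros Hpos.
assert (Hh := proj1 H); assert (HPI := PI_RGT_0).
assert (Hc : 0 < h t0 / 2) by lra.
destruct (cts_at _ Hh t0 _ (locally_ball (h t0) (mkposreal _ Hc))) as [d0 Hd0].
assert (Hd0p := cond_pos d0).
(* [d <= d0 / 2] keeps [h] above [h t0 / 2] near [t0], [d <= PI / 2] makes [cos d] nonnegative, and
   the last two bounds keep the window inside the period. *)
set (d := Rmin (Rmin (d0 / 2) (PI / 2)) (Rmin t0 (2 * PI - t0))).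
assert (Hd : 0 < d /\ d <= d0 / 2 /\ d <= PI / 2 /\ d <= t0 /\ d <= 2 * PI - t0).
{ unfold d; split; [repeat apply Rmin_glb_lt; lra|].
  assert (A1 := Rmin_l (Rmin (d0 / 2) (PI / 2)) (Rmin t0 (2 * PI - t0))).
  assert (A2 := Rmin_r (Rmin (d0 / 2) (PI / 2)) (Rmin t0 (2 * PI - t0))).
  assert (A3 := Rmin_l (d0 / 2) (PI / 2)); assert (A4 := Rmin_r (d0 / 2) (PI / 2)).
  assert (A5 := Rmin_l t0 (2 * PI - t0)); assert (A6 := Rmin_r t0 (2 * PI - t0)); lra. }
clearbody d.
assert (Hh' : forall t, Rabs (t - t0) <= d -> h t0 / 2 <= h t).
{ intros t Ht; assert (A : Rabs (h t - h t0) < h t0 / 2).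
    apply (Hd0 t); change (Rabs (t - t0) < d0); lra.
  apply Rabs_def2 in A; lra. }
assert (Hcd : 0 <= cos d) by (apply cos_ge_0; lra).
set (w := fun t => / (1 + cos d) * (1 + cos (t - t0))).
set (w0 := / (1 + cos d) * (1 + cos (d / 2))).
assert (Hi : 0 < / (1 + cos d)) by (apply Rinv_0_lt_compat; lra).
assert (Hw0 : 1 < w0).
{ assert (A : cos d < cos (d / 2)) by (apply cos_decreasing_1; lra).
  unfold w0; apply Rmult_lt_reg_l with (1 + cos d); [lra|].
  rewrite <- Rmult_assoc, Rinv_r by lra; lra. }
assert (Hwpos : forall t, 0 <= w t).
{ intros t; unfold w; assert (A := COS_bound (t - t0)); apply Rmult_le_pos; lra. }
assert (Hwin : forall t, Rabs (t - t0) <= d / 2 -> w0 <= w t).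
{ intros t Ht; unfold w, w0; apply Rmult_le_compat_l; [lra|]; apply Rplus_le_compat_l.
  replace (cos (t - t0)) with (cos (Rabs (t - t0))).
    apply cos_decr_1; try lra; apply Rabs_pos.
  unfold Rabs; destruct (Rcase_abs (t - t0)); [apply cos_neg | reflexivity]. }
assert (Hwout : forall t, 0 <= t <= 2 * PI -> d <= Rabs (t - t0) -> w t <= 1).
{ intros t Ht Hdt; unfold w; apply Rmult_le_reg_l with (1 + cos d); [lra|].
  rewrite <- Rmult_assoc, Rinv_r by lra.
  replace (cos (t - t0)) with (cos (Rabs (t - t0))).
    assert (A : cos (Rabs (t - t0)) <= cos d); [|lra].
    apply cos_le_away; [lra|]; split; [exact Hdt|].
    unfold Rabs; destruct (Rcase_abs (t - t0)); lra.
  unfold Rabs; destruct (Rcase_abs (t - t0)); [apply cos_neg | reflexivity]. }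
set (g := fun n t => h t * w t ^ n).
assert (Hg : forall n, cts (g n)) by (intros n; apply (fourier_null_kernel h _ t0 n H)).
assert (Hw1 : forall n t, 0 <= t <= 2 * PI -> d <= Rabs (t - t0) -> - Rabs (h t) <= g n t).
{ intros n t Ht Hdt; unfold g.
  assert (A1 : 0 <= w t ^ n <= 1).
  { split; [apply pow_le, Hwpos|]; rewrite <- (pow1 n); apply pow_incr; split; [apply Hwpos | apply Hwout; assumption]. }
  assert (A2 := Rabs_pos (h t)); assert (A3 := Rle_abs (- h t)); rewrite Rabs_Ropp in A3; nra. }
assert (Hm : forall n t, Rabs (t - t0) <= d -> 0 <= g n t).
{ intros n t Ht; unfold g; apply Rmult_le_pos; [assert (A := Hh' t Ht); lra | apply pow_le, Hwpos]. }
assert (Ha : cts (fun t => - Rabs (h t))).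
{ apply (cts_Ropp (fun t => Rabs (h t))), (cts_comp Rabs h); [|exact Hh].
  constructor; intros t; apply continuous_Rabs. }
set (I0 := RInt (fun t => - Rabs (h t)) 0 (t0 - d / 2)).
set (I1 := RInt (fun t => - Rabs (h t)) (t0 + d / 2) (2 * PI)).
(* Within distance [d] of [t0] the integrand is nonnegative, and beyond it [w t <= 1]; in both cases
   [- Rabs (h t)] is a lower bound independent of [n]. It is used outside the half window, whose
   length [d] appears in [Hn]. *)
assert (Hlow : forall n t, 0 <= t <= 2 * PI -> - Rabs (h t) <= g n t).
{ intros n t Ht; destruct (Rle_dec d (Rabs (t - t0))) as [A|A]; [apply Hw1; assumption|].
  assert (A1 := Hm n t ltac:(lra)); assert (A2 := Rabs_pos (h t)); lra. }
assert (Hn : forall n, I0 + h t0 / 2 * w0 ^ n * d + I1 <= 0).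
{ intros n.
  assert (B0 : I0 <= RInt (g n) 0 (t0 - d / 2)).
  { apply RInt_le; [lra | apply ex_RInt_cts, Ha | apply ex_RInt_cts, Hg |].
    intros t Ht; apply Hlow; lra. }
  assert (B1 : I1 <= RInt (g n) (t0 + d / 2) (2 * PI)).
  { apply RInt_le; [lra | apply ex_RInt_cts, Ha | apply ex_RInt_cts, Hg |].
    intros t Ht; apply Hlow; lra. }
  assert (B2 : h t0 / 2 * w0 ^ n * ((t0 + d / 2) - (t0 - d / 2)) <= RInt (g n) (t0 - d / 2) (t0 + d / 2)).
  { apply RInt_ge_const; [lra | apply Hg|]; intros t Ht.
    assert (At : Rabs (t - t0) <= d / 2) by (apply Rabs_le; lra).
    unfold g; apply Rmult_le_compat; [lra | apply pow_le; lra | apply Hh'; lra|].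
    apply pow_incr; split; [lra | apply Hwin, At]. }
  assert (B3 := fourier_null_RInt _ (fourier_null_kernel h (/ (1 + cos d)) t0 n H)).
  change (RInt (g n) 0 (2 * PI) = 0) in B3.
  rewrite <- (RInt_Chasles (V := R_CompleteNormedModule) (g n) 0 (t0 - d / 2) (2 * PI)),
    <- (RInt_Chasles (V := R_CompleteNormedModule) (g n) (t0 - d / 2) (t0 + d / 2) (2 * PI)) in B3
    by apply ex_RInt_cts, Hg.
  unfold plus in B3; simpl in B3; lra. }
assert (Hq : 0 < h t0 / 2 * d) by (apply Rmult_lt_0_compat; lra).
(* Bernoulli's inequality ([poly]) gives [w0 ^ n >= 1 + n (w0 - 1)]; this [n] makes the window
   outweigh [Rabs (I0 + I1)]. *)
destruct (INR_unbounded (Rabs (I0 + I1) / (h t0 / 2 * d * (w0 - 1)))) as [n Hn1].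
assert (P := poly n (w0 - 1) ltac:(lra)).
replace (1 + (w0 - 1)) with w0 in P by ring.
assert (Q := Hn n).
apply Rmult_lt_compat_l with (r := h t0 / 2 * d * (w0 - 1)) in Hn1; [|apply Rmult_lt_0_compat; lra].
replace (h t0 / 2 * d * (w0 - 1) * (Rabs (I0 + I1) / (h t0 / 2 * d * (w0 - 1)))) with (Rabs (I0 + I1)) in Hn1
  by (field; lra).
assert (Q1 := Rle_abs (- (I0 + I1))); rewrite Rabs_Ropp in Q1.
apply Rmult_le_compat_l with (r := h t0 / 2 * d) in P; [|lra].
lra.
Qed.

(** [fourier_null_nonpos] is applied to [h] and to [- h]; the end point 0, excluded there, follows
    by continuity. *)
Lemma fourier_null_zero h t : fourier_null h -> 0 <= t < 2 * PI -> h t = 0.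
Proof.
intros H Ht.
assert (H0 : forall t0, 0 < t0 < 2 * PI -> h t0 = 0).
{ intros t0 Ht0; apply Rle_antisym; [apply fourier_null_nonpos; assumption|].
  assert (K := fourier_null_nonpos (fun t => - 1 * h t + 0 * h t) t0 (fourier_null_lin _ _ _ _ H H) Ht0).
  simpl in K; lra. }
destruct (Rle_lt_or_eq_dec 0 t (proj1 Ht)) as [Hlt|<-]; [apply H0; lra|].
destruct (Req_dec (h 0) 0) as [E|E]; [exact E | exfalso].
assert (Hp := Rabs_pos_lt _ E).
destruct (cts_at _ (proj1 H) 0 _ (locally_ball (h 0) (mkposreal _ Hp))) as [d Hd].
assert (Hdp := cond_pos d); assert (HPI := PI_RGT_0).
set (s := Rmin (d / 2) PI).
assert (Hs : 0 < s /\ s <= d / 2 /\ s <= PI).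
{ unfold s; repeat split; [apply Rmin_glb_lt; lra | apply Rmin_l | apply Rmin_r]. }
assert (A : Rabs (h s - h 0) < Rabs (h 0)).
{ apply (Hd s); change (Rabs (s - 0) < d); rewrite Rminus_0_r, Rabs_pos_eq; lra. }
rewrite (H0 s) in A by lra; rewrite Rminus_0_l, Rabs_Ropp in A; lra.
Qed.

(** * Supports *)

Lemma circ_pow x t k : (circ x t ^ k = RtoC (x ^ k) * (cos (INR k * t), sin (INR k * t)))%C.
Proof.
induction k as [|k IH].
  simpl; rewrite Rmult_0_l, cos_0, sin_0; apply injective_projections; simpl; ring.
rewrite Cpow_S, IH, S_INR, circ_eq.
replace ((INR k + 1) * t) with (INR k * t + t) by ring.
rewrite cos_plus, sin_plus; apply injective_projections; simpl; ring.
Qed.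

Lemma mom_fourier k f x : cts (U := C_U) (V := C_U) f -> x <> 0 -> mom k f x = RtoC 0 ->
  RInt (fun t => fst (f (circ x t)) * cos (INR k * t) - snd (f (circ x t)) * sin (INR k * t)) 0 (2 * PI) = 0 /\
  RInt (fun t => fst (f (circ x t)) * sin (INR k * t) + snd (f (circ x t)) * cos (INR k * t)) 0 (2 * PI) = 0.
Proof.
intros Hf Hx H.
set (g := fun t => (fst (f (circ x t)) * cos (INR k * t) - snd (f (circ x t)) * sin (INR k * t),
  fst (f (circ x t)) * sin (INR k * t) + snd (f (circ x t)) * cos (INR k * t)) : C).
assert (Hg : cts (V := C_U) g) by (apply cts_C; simpl; cts_tac).
assert (E : (RtoC (x ^ k) * cint g 0 (2 * PI) = RtoC 0)%C).
{ rewrite <- H, <- cint_scal by exact Hg; apply cint_ext; intros t.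
  rewrite circ_pow; apply injective_projections; simpl; ring. }
assert (E' : cint g 0 (2 * PI) = RtoC 0).
{ destruct (Ceq_dec (cint g 0 (2 * PI)) (RtoC 0)) as [E0|E0]; [exact E0|].
  exfalso; apply (Cmult_neq_0 (RtoC (x ^ k)) (cint g 0 (2 * PI))); [|exact E0 | exact E].
  intros A; apply RtoC_inj in A; exact (pow_nonzero x k Hx A). }
split; [exact (f_equal fst E') | exact (f_equal snd E')].
Qed.

Lemma fourier_null_nat h : cts h ->
  (forall k, RInt (fun t => h t * cos (INR k * t)) 0 (2 * PI) = 0 /\
             RInt (fun t => h t * sin (INR k * t)) 0 (2 * PI) = 0) -> fourier_null h.
Proof.
intros Hh H; split; [exact Hh|]; intros n.
destruct (Z_le_dec 0 n) as [Hn|Hn].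
  rewrite <- (Z2Nat.id n Hn), <- INR_IZR_INZ; apply H.
destruct (H (Z.to_nat (- n))) as [Hc Hs].
assert (E : IZR n = - INR (Z.to_nat (- n))).
{ rewrite INR_IZR_INZ, Z2Nat.id by lia; rewrite opp_IZR; ring. }
split.
  eapply eq_trans; [|exact Hc]; apply RInt_ext; intros t _.
  rewrite E, Ropp_mult_distr_l_reverse, cos_neg; reflexivity.
apply (RInt_lin2_null _ (fun t => h t * sin (INR (Z.to_nat (- n)) * t))
  (fun t => h t * sin (INR (Z.to_nat (- n)) * t)) (- 1) 0); [cts_tac | cts_tac | | exact Hs | exact Hs].
intros t; rewrite E, Ropp_mult_distr_l_reverse, sin_neg; ring.
Qed.

(** With [f = u + i v], the two families of moments are multiples of the integrals of
    [(u + i v) e^(i k t)] and [(u - i v) e^(i k t)]. Half sums and half differences isolate the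
    coefficients of the real functions [u] and [v], for which [k >= 0] suffices. *)
Lemma circle_vanish f x t : cts (U := C_U) (V := C_U) f -> x <> 0 ->
  (forall k, mom k f x = RtoC 0) -> (forall k, mom k (fun z => Cconj (f z)) x = RtoC 0) ->
  0 <= t < 2 * PI -> f (circ x t) = RtoC 0.
Proof.
intros Hf Hx H H' Ht.
set (u := fun t => fst (f (circ x t))); set (v := fun t => snd (f (circ x t))).
assert (Hu : cts u) by (unfold u; cts_tac).
assert (Hv : cts v) by (unfold v; cts_tac).
assert (K : forall k,
  (RInt (fun t => u t * cos (INR k * t) - v t * sin (INR k * t)) 0 (2 * PI) = 0 /\
   RInt (fun t => u t * sin (INR k * t) + v t * cos (INR k * t)) 0 (2 * PI) = 0) /\
  (RInt (fun t => u t * cos (INR k * t) - - v t * sin (INR k * t)) 0 (2 * PI) = 0 /\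
   RInt (fun t => u t * sin (INR k * t) + - v t * cos (INR k * t)) 0 (2 * PI) = 0)).
{ intros k; split.
    apply (mom_fourier k f x Hf Hx (H k)).
  apply (mom_fourier k (fun z => Cconj (f z)) x); [cts_tac | exact Hx | apply H']. }
assert (Nu : fourier_null u).
{ apply fourier_null_nat; [exact Hu|]; intros k; destruct (K k) as [[K1 K2] [K3 K4]]; split.
    eapply (RInt_lin2_null _ _ _ (/ 2) (/ 2)); [| | |exact K1|exact K3]; [cts_tac | cts_tac | intros t'; simpl; field].
  eapply (RInt_lin2_null _ _ _ (/ 2) (/ 2)); [| | |exact K2|exact K4]; [cts_tac | cts_tac | intros t'; simpl; field]. }
assert (Nv : fourier_null v).
{ apply fourier_null_nat; [exact Hv|]; intros k; destruct (K k) as [[K1 K2] [K3 K4]]; split.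
    eapply (RInt_lin2_null _ _ _ (/ 2) (- / 2)); [| | |exact K2|exact K4]; [cts_tac | cts_tac | intros t'; simpl; field].
  eapply (RInt_lin2_null _ _ _ (/ 2) (- / 2)); [| | |exact K3|exact K1]; [cts_tac | cts_tac | intros t'; simpl; field]. }
apply injective_projections.
  exact (fourier_null_zero u t Nu Ht).
exact (fourier_null_zero v t Nv Ht).
Qed.

(** The radius is negative to match [mom_vanish]; hence the cosine of the angle is [- a / m]. *)
Lemma polar_form (z : C) : z <> RtoC 0 -> exists t, 0 <= t < 2 * PI /\ z = circ (- Cmod z) t.
Proof.
intros Hz; destruct z as [a b]; set (m := Cmod (a, b)).
assert (Hm : 0 < m) by (apply Cmod_gt_0, Hz).
assert (Hm2 : a * a + b * b = m * m).
{ unfold m, Cmod; rewrite sqrt_sqrt; simpl; nra. }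
assert (HPI := PI_RGT_0).
set (c := - a / m).
assert (Hc : a = - m * c) by (unfold c; field; lra).
clearbody m c.
assert (Hcc : c * c <= 1).
{ apply Rmult_le_reg_r with (m * m); [nra|]; replace (c * c * (m * m)) with (a * a) by (rewrite Hc; ring); nra. }
assert (Hc1 : -1 <= c <= 1) by (split; nra).
assert (Hs : Rabs b = m * sqrt (1 - c * c)).
{ rewrite <- (sqrt_square m) at 1 by lra; rewrite <- sqrt_mult by nra.
  rewrite <- sqrt_Rsqr_abs; f_equal; unfold Rsqr; rewrite Hc in Hm2; nra. }
destruct (acos_bound c) as [A1 A2].
assert (A3 := cos_acos c Hc1); assert (A4 := sin_acos c Hc1).
unfold Rsqr in A4.
destruct (Rle_dec b 0) as [Hb|Hb].
- exists (acos c); split; [lra|].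
  rewrite circ_eq, A3, A4; apply injective_projections; simpl; [exact Hc|].
  rewrite Rabs_left1 in Hs by exact Hb; lra.
- rewrite Rabs_pos_eq in Hs by lra.
  exists (2 * PI - acos c); split.
    split; [lra|].
    (* The angle [2 * PI - acos c] stays below [2 * PI]: [acos c = 0] would give [b = 0], but here
       [b > 0]. *)
    destruct (Rle_lt_or_eq_dec 0 _ A1) as [A|A]; [lra|].
    rewrite <- A, sin_0 in A4; rewrite <- A4 in Hs; lra.
  rewrite circ_eq, cos_minus, sin_minus, cos_2PI, sin_2PI, A3, A4.
  apply injective_projections; simpl; [lra|lra].
Qed.

(** * Twisted means and supports in discs *)

Lemma circle_mean_eq s (g : C -> C) : cts (fun t => g (circ s t)) ->
  circle_mean s g = (RtoC (/ (2 * PI)) * cint (fun t => g (circ s t)) 0 (2 * PI))%C.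
Proof. intros H; unfold circle_mean; rewrite <- RInt_cint by exact H; reflexivity. Qed.

Lemma twisted_mean_right_tint (f : C -> C) s z : cts (U := C_U) (V := C_U) f ->
  twisted_mean_right f s z = (RtoC (/ (2 * PI)) * tint (/ 2) f s z)%C.
Proof.
intros Hf; unfold twisted_mean_right; rewrite circle_mean_eq by (unfold Im; cts_tac).
f_equal; apply cint_ext; intros t; do 3 f_equal.
rewrite RtoC_inv by lra; reflexivity.
Qed.

Lemma twisted_mean_left_tint (f : C -> C) s z : cts (U := C_U) (V := C_U) f ->
  twisted_mean_left f s z = (RtoC (/ (2 * PI)) * tint (- / 2) f s z)%C.
Proof.
intros Hf; unfold twisted_mean_left; rewrite circle_mean_eq by (unfold Im; cts_tac).
f_equal; apply cint_ext; intros t; do 3 f_equal.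
rewrite RtoC_opp, RtoC_inv by lra; unfold Cdiv; ring.
Qed.

Lemma tint_vanish_support r f z : 0 <= r -> cts (U := C_U) (V := C_U) f -> tint_vanish r f ->
  r < Cmod z -> f z = RtoC 0.
Proof.
intros Hr Hf H Hz.
destruct (polar_form z) as [t [Ht E]].
  intros ->; rewrite Cmod_0 in Hz; lra.
rewrite E; apply circle_vanish; [exact Hf | lra | | | exact Ht]; intros k.
  apply (mom_vanish r); assumption.
apply (mom_vanish r); [exact Hr | cts_tac | apply tint_vanish_conj; assumption | exact Hz].
Qed.

(** On [|w| = s] one has [|z - w| >= s - |z| > r], so the integrand is identically zero. *)
Lemma vanish_tint l r f s z : 0 <= r -> (forall w, r < Cmod w -> f w = RtoC 0) ->
  r + Cmod z < s -> tint l f s z = RtoC 0.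
Proof.
intros Hr H Hs; assert (Hz := Cmod_ge_0 z).
transitivity (cint (fun _ => RtoC 0) 0 (2 * PI)); [|rewrite cint_const; ring].
apply cint_ext; intros t; rewrite H; [ring|].
assert (E : Cmod (circ s t) = s).
{ unfold circ; rewrite Cmod_mult, Cmod_R, Cexp_Ci, Rabs_pos_eq by lra.
  assert (T := sin2_cos2 t); unfold Rsqr in T; unfold Cmod; simpl.
  replace (cos t * (cos t * 1) + sin t * (sin t * 1)) with (sin t * sin t + cos t * cos t) by ring.
  rewrite T, sqrt_1; ring. }
assert (A := Cmod_triangle (z - circ s t) (- z)).
replace (z - circ s t + - z)%C with (- circ s t)%C in A by ring.
rewrite !Cmod_opp, E in A; lra.
Qed.

Lemma supported_in_disc r f :
  supported_in f (fun z => Cmod z <= r) <-> forall z, r < Cmod z -> f z = RtoC 0.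
Proof.
split; intros H z Hz.
- destruct (Ceq_dec (f z) (RtoC 0)) as [E|E]; [exact E | exfalso].
  assert (A : Cmod z <= r); [|lra].
  apply H; intros P HP; exists z; split; [apply locally_singleton, HP | exact E].
- apply Rnot_lt_le; intros Hr.
  (* Half of the distance to the disc: a [ball] of radius [d] in the plane is a square, on which
     [|y - z|] is only bounded by [sqrt 2 * d], and [sqrt 2 < 2]. *)
  assert (Hd : 0 < (Cmod z - r) / 2) by lra.
  destruct (Hz (fun y => r < Cmod y)) as [y [Hy1 Hy2]]; [|exact (Hy2 (H y Hy1))].
  exists (mkposreal _ Hd); intros y Hy.
  assert (A := C_NormedModule_mixin_compat2 z y (mkposreal _ Hd) Hy).
  change (Cmod (y - z) < sqrt 2 * ((Cmod z - r) / 2)) in A.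
  assert (S2 : sqrt 2 < 2).
  { rewrite <- (sqrt_square 2) at 2 by lra; apply sqrt_lt_1; lra. }
  assert (B := Cmod_triangle y (- (y - z))).
  replace (y + - (y - z))%C with z in B by ring.
  rewrite Cmod_opp in B; nra.
Qed.

Theorem theorem1p3 (r : R) (hr : 0 <= r) (f : C -> C)
    (hf : forall z : C, @continuous C_UniformSpace C_UniformSpace f z) :
  supported_in f (fun z : C => Cmod z <= r) <->
  (forall (z : C) (s : R), r + Cmod z < s ->
     twisted_mean_right f s z = RtoC 0 /\ twisted_mean_left f s z = RtoC 0).
Proof.
assert (Hf : cts (U := C_U) (V := C_U) f) by (constructor; exact hf).
rewrite supported_in_disc; split.
- intros H z s Hs.
  rewrite twisted_mean_right_tint, twisted_mean_left_tint by exact Hf.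
  rewrite !(vanish_tint _ r) by assumption; split; ring.
- intros H z Hz; apply (tint_vanish_support r); [exact hr | exact Hf | | exact Hz].
  assert (K : forall c, (RtoC (/ (2 * PI)) * c)%C = RtoC 0 -> c = RtoC 0).
  { intros c E; destruct (Ceq_dec c (RtoC 0)) as [E0|E0]; [exact E0 | exfalso].
    apply (Cmult_neq_0 (RtoC (/ (2 * PI))) c); [|exact E0 | exact E].
    intros A; apply RtoC_inj in A; assert (HPI := PI_RGT_0).
    apply (Rinv_neq_0_compat (2 * PI)); lra. }
  intros w s Hs; destruct (H w s Hs) as [H1 H2].
  rewrite twisted_mean_right_tint in H1 by exact Hf.
  rewrite twisted_mean_left_tint in H2 by exact Hf.
  split; apply K; assumption.
Qed.
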